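(* Let $k\geqslant 1$, let $I$ be an ideal in the ring $R=\mathbb Z[x_1^{\pm 1},x_2^{\pm 1},\dots,x_k^{\pm 1}]$ with a finite generating set $F$, and write $C_I(m,n)=C_{I,F}(m,n)$ for the complexity function. Then there exist a finitely generated metabelian group $G_I$ with a finite relative presentation $\mathcal P$ (relative to the variety of metabelian groups) and a constant $C>0$ such that $$\tilde\delta_{G_I,\mathcal P}(C\cdot mn)\geqslant C_I(m,n)\quad\text{for all integers } m,n\geqslant 1,$$ where $\tilde\delta_{G_I,\mathcal P}$ is the Dehn function of $G_I$ relative to the variety of metabelian groups with respect to $\mathcal P$. In particular, if $I$ is tame, then there exist a finite presentation $\mathcal P'$ of (the same group) $G_I$ and a constant $C'>0$ such that $$C'\cdot\delta_{G_I,\mathcal P'}(C'mn)+C'mn+C'\geqslant C_I(m,n)\quad\text{for all integers } m,n\geqslant 1,$$ where $\delta_{G_I,\mathcal P'}$ is the Dehn function of $G_I$ with respect to $\mathcal P'$.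
   Context: Complexity function. For $d\in\mathbb Z^k$ write $x^d=x_1^{d_1}\cdots x_k^{d_k}$ and $\|d\|=|d_1|+\dots+|d_k|$. For $g=\sum_i\alpha_{d_i}x^{d_i}\in R$ (distinct exponents $d_i$, nonzero integers $\alpha_{d_i}$), put $|g|=\sum_i|\alpha_{d_i}|$ and $\deg g=\max_i\|d_i\|$ (with $|0|=\deg 0=0$). For an ideal $I$ generated by $F=\{f_1,\dots,f_s\}$ and $g\in I$, $$\operatorname{Area}_{I,F}(g)=\min\Big\{\sum_{i=1}^s|h_i| \;\Big|\; g=\sum_{i=1}^s h_if_i,\ h_i\in R\Big\},\qquad C_{I,F}(m,n)=\sup\{\operatorname{Area}_{I,F}(g)\mid g\in I,\ |g|\leqslant m,\ \deg g\leqslant n\}.$$ Dehn function. Let $G$ be a group with a finite presentation $\mathcal P'=\langle X\mid S\rangle$. For a word $w$ over $X^{\pm1}$ representing $1$ in $G$, its area $\operatorname{Area}_{\mathcal P'}(w)$ is the smallest $l$ such that $w=\prod_{i=1}^l u_i^{-1}r_iu_i$ in the free group $F(X)$ with $r_i\in S\cup S^{-1}$, $u_i\in F(X)$. For real $t\geqslant 0$, $\delta_{G,\mathcal P'}(t)=\sup\{\operatorname{Area}_{\mathcal P'}(w)\mid w=_G1,\ |w|_X\leqslant t\}$, where $|w|_X$ is word length. Relative Dehn function. Let $\mathcal A^2$ denote the variety of metabelian groups. A finite relative presentation $\mathcal P=\langle X\mid S\rangle_{\mathcal A^2}$ of a metabelian group $G$ consists of a finite set $X$ and a finite subset $S$ of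 the free metabelian group $M_X$ on $X$ such that $G\cong M_X/\langle\langle S\rangle\rangle$, where $\langle\langle S\rangle\rangle$ is the normal closure of $S$ in $M_X$. For a word $w$ over $X^{\pm1}$ representing $1$ in $G$, its relative area is the smallest $l$ such that $w=\prod_{i=1}^l u_i^{-1}r_iu_i$ in $M_X$ with $r_i\in S\cup S^{-1}$, $u_i\in M_X$. For real $t\geqslant 0$, $\tilde\delta_{G,\mathcal P}(t)$ is the supremum of the relative areas of words $w$ with $w=_G1$ and $|w|_X\leqslant t$. Tameness. Let $Q\cong\mathbb Z^k$ be the multiplicative group of monomials $x^d$, so that $\mathbb ZQ=R$. For a homomorphism $\chi:Q\to\mathbb R$ (additive reals) put $Q_\chi=\{q\in Q\mid\chi(q)\geqslant0\}$. A $\mathbb ZQ$-module $M$ is tame if for every homomorphism $\chi:Q\to\mathbb R$, $M$ is finitely generated as a $\mathbb ZQ_\chi$-module or as a $\mathbb ZQ_{-\chi}$-module (or both). The ideal $I$ is called tame if the $\mathbb ZQ$-module $R/I$ is tame. *)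

(* Defs.v *)
From HB Require Import structures.
From mathcomp Require Import all_boot all_order all_algebra finmap.
From mathcomp Require Import ring_quotient generic_quotient.
From mathcomp Require Import boolp classical_sets reals constructive_ereal ereal.

Set Implicit Arguments.
Unset Strict Implicit.
Unset Printing Implicit Defensive.

Import Order.TTheory GRing.Theory Num.Theory.

Local Open Scope classical_set_scope.
Local Open Scope quotient_scope.
Local Open Scope ring_scope.

(* The least natural number satisfying P. The value 0 for an empty P is never
   used below: areas are only taken of elements of the ideal or of the normal
   closure of the relators. *)
Definition least (P : nat -> Prop) : nat :=
  if pselect (exists n, `[< P n >]) is left exP then ex_minn exP else 0%N.

Lemma leastP (P : nat -> Prop) n :
  P n -> P (least P) /\ (least P <= n)%N.
Proof.
move=> Pn; rewrite /least; case: pselect => [exP|]; last first.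
  by case; exists n; apply/asboolP.
case: ex_minnP => m /asboolP Pm min_m; split=> //.
by apply: min_m; apply/asboolP.
Qed.

(* The group A is written additively; the element f : {group_ring A} stands
   for \sum_a (f a) x^a. *)
Definition group_ring (A : zmodType) : Type := {fsfun A -> int with 0}.
Notation "{ 'group_ring' A }" := (group_ring A)
  (at level 0, format "{ 'group_ring'  A }") : type_scope.

Section GroupRing.
Variable A : zmodType.
Implicit Types (f g h : {group_ring A}) (a b : A) (c : int).

HB.instance Definition _ := Choice.copy {group_ring A} {fsfun A -> int with 0}.

Definition gr_coef f a : int := (f : {fsfun A -> int with 0}) a.
Definition gr_supp f : {fset A} := finsupp (f : {fsfun A -> int with 0}).

Definition gr_mono c a : {group_ring A} := [fsfun _ in [fset a]%fset => c].
Definition gr_zero : {group_ring A} := [fsfun].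
Definition gr_opp f : {group_ring A} :=
  [fsfun a in gr_supp f => - gr_coef f a].
Definition gr_add f g : {group_ring A} :=
  [fsfun a in (gr_supp f `|` gr_supp g)%fset => gr_coef f a + gr_coef g a].

Lemma gr_ext f g : (forall a, gr_coef f a = gr_coef g a) -> f = g.
Proof. by move=> e; apply/fsfunP. Qed.

Lemma gr_out f a : a \notin gr_supp f -> gr_coef f a = 0.
Proof. exact: fsfun_dflt. Qed.

Lemma gr_coef_mono c a b : gr_coef (gr_mono c a) b = c *+ (a == b).
Proof. by rewrite /gr_coef fsfun_fun in_fset1 eq_sym; case: eqP. Qed.

Lemma gr_coef_zero a : gr_coef gr_zero a = 0.
Proof. by rewrite /gr_coef fsfun0E. Qed.

Lemma gr_coef_opp f a : gr_coef (gr_opp f) a = - gr_coef f a.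
Proof.
rewrite /gr_coef fsfun_fun; case: ifP => // /negbT.
by rewrite -/(gr_coef f a) => /gr_out ->; rewrite oppr0.
Qed.

Lemma gr_coef_add f g a : gr_coef (gr_add f g) a = gr_coef f a + gr_coef g a.
Proof.
rewrite {1}/gr_coef fsfun_fun; case: ifP => // /negbT.
by rewrite in_fsetU negb_or => /andP[/gr_out -> /gr_out ->]; rewrite addr0.
Qed.

Let grE := (gr_coef_add, gr_coef_opp, gr_coef_zero).

Fact gr_addA : associative gr_add.
Proof. by move=> f g h; apply: gr_ext => a; rewrite !grE addrA. Qed.
Fact gr_addC : commutative gr_add.
Proof. by move=> f g; apply: gr_ext => a; rewrite !grE addrC. Qed.
Fact gr_add0 : left_id gr_zero gr_add.
Proof. by move=> f; apply: gr_ext => a; rewrite !grE add0r. Qed.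
Fact gr_addN : left_inverse gr_zero gr_opp gr_add.
Proof. by move=> f; apply: gr_ext => a; rewrite !grE addNr. Qed.

HB.instance Definition _ := GRing.isZmodule.Build {group_ring A}
  gr_addA gr_addC gr_add0 gr_addN.

Lemma gr_coefD f g a : gr_coef (f + g) a = gr_coef f a + gr_coef g a.
Proof. exact: gr_coef_add. Qed.
Lemma gr_coef0 a : gr_coef 0 a = 0.
Proof. exact: gr_coef_zero. Qed.
Lemma gr_coefN f a : gr_coef (- f) a = - gr_coef f a.
Proof. exact: gr_coef_opp. Qed.

Lemma gr_coef_sum (J : Type) (r : seq J) (P : pred J)
    (F : J -> {group_ring A}) a :
  gr_coef (\sum_(j <- r | P j) F j) a = \sum_(j <- r | P j) gr_coef (F j) a.
Proof.
apply: (big_morph (gr_coef^~ a)) => [f g|]; first exact: gr_coefD.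
exact: gr_coef0.
Qed.

Lemma gr_monoD c c' a : gr_mono (c + c') a = gr_mono c a + gr_mono c' a.
Proof. by apply: gr_ext => b; rewrite gr_coefD !gr_coef_mono mulrnDl. Qed.

Lemma gr_mono0 a : gr_mono 0 a = 0.
Proof. by apply: gr_ext => b; rewrite gr_coef0 gr_coef_mono mul0rn. Qed.

Lemma gr_supp_mono c a : (gr_supp (gr_mono c a) `<=` [fset a])%fset.
Proof.
apply/fsubsetP => b; rewrite in_fset1 eq_sym; apply: contraLR => /negbTE ab.
by rewrite memNfinsupp -/(gr_coef _ _) gr_coef_mono ab.
Qed.

Lemma gr_suppD f g : (gr_supp (f + g)%R `<=` gr_supp f `|` gr_supp g)%fset.
Proof.
apply/fsubsetP => b; apply: contraLR; rewrite in_fsetU negb_or.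
move=> /andP[/gr_out fb /gr_out gb].
by rewrite memNfinsupp -/(gr_coef _ _) gr_coefD fb gb.
Qed.

Lemma gr_expand f : f = \sum_(a <- gr_supp f) gr_mono (gr_coef f a) a.
Proof.
apply: gr_ext => b; rewrite gr_coef_sum.
have [bf|bf] := boolP (b \in gr_supp f).
  rewrite (big_fsetD1 b) //= gr_coef_mono eqxx big1_fset ?addr0 // => a.
  by rewrite in_fsetD1 gr_coef_mono => /andP[/negbTE ->].
rewrite gr_out // big1_fset // => a af _; rewrite gr_coef_mono.
by case: eqP bf => // <-; rewrite af.
Qed.

Definition gr_mul f g : {group_ring A} :=
  \sum_(a <- gr_supp f) \sum_(b <- gr_supp g)
    gr_mono (gr_coef f a * gr_coef g b) (a + b).
Definition gr_one : {group_ring A} := gr_mono 1 0.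

Lemma gr_mulw (D E : {fset A}) f g :
    (gr_supp f `<=` D)%fset -> (gr_supp g `<=` E)%fset ->
  gr_mul f g = \sum_(a <- D) \sum_(b <- E)
    gr_mono (gr_coef f a * gr_coef g b) (a + b).
Proof.
move=> fD gE; rewrite /gr_mul (big_fset_incl _ fD) /=; last first.
  move=> a _ /gr_out ->; rewrite big1 // => b _.
  by rewrite mul0r gr_mono0.
apply: eq_bigr => a _; apply: big_fset_incl => // b _ /gr_out ->.
by rewrite mulr0 gr_mono0.
Qed.

Fact gr_mulC : commutative gr_mul.
Proof.
move=> f g; rewrite /gr_mul exchange_big; apply: eq_bigr => a _.
by apply: eq_bigr => b _; rewrite mulrC addrC.
Qed.

Fact gr_mulDl : left_distributive gr_mul +%R.
Proof.
move=> f g h.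
rewrite (gr_mulw (gr_suppD f g) (fsubset_refl _)).
rewrite (gr_mulw (fsubsetUl _ (gr_supp g)) (fsubset_refl _)).
rewrite (gr_mulw (fsubsetUr (gr_supp f) _) (fsubset_refl _)).
rewrite -big_split; apply: eq_bigr => a _.
rewrite -big_split; apply: eq_bigr => b _ /=.
by rewrite gr_coefD mulrDl gr_monoD.
Qed.

Lemma gr_mulDr : right_distributive gr_mul +%R.
Proof. by move=> f g h; rewrite !(gr_mulC f) gr_mulDl. Qed.

Lemma gr_mul0 f : gr_mul 0 f = 0.
Proof. by apply: (addIr (gr_mul 0 f)); rewrite -gr_mulDl !add0r. Qed.

Lemma gr_mulr0 f : gr_mul f 0 = 0.
Proof. by rewrite gr_mulC gr_mul0. Qed.

Lemma gr_mul_mono c c' a b :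
  gr_mul (gr_mono c a) (gr_mono c' b) = gr_mono (c * c') (a + b).
Proof.
rewrite (gr_mulw (gr_supp_mono _ _) (gr_supp_mono _ _)) !big_seq_fset1.
by rewrite !gr_coef_mono !eqxx.
Qed.

Lemma gr_mul_suml (J : Type) (r : seq J) (F : J -> {group_ring A}) g :
  gr_mul (\sum_(j <- r) F j) g = \sum_(j <- r) gr_mul (F j) g.
Proof.
by apply: (big_morph (gr_mul^~ g)) => [x y|]; rewrite ?gr_mulDl ?gr_mul0.
Qed.

Lemma gr_mul_sumr (J : Type) (r : seq J) (F : J -> {group_ring A}) g :
  gr_mul g (\sum_(j <- r) F j) = \sum_(j <- r) gr_mul g (F j).
Proof.
by apply: (big_morph (gr_mul g)) => [x y|]; rewrite ?gr_mulDr ?gr_mulr0.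
Qed.

Fact gr_mulA : associative gr_mul.
Proof.
have A1 c c' a b h : gr_mul (gr_mono c a) (gr_mul (gr_mono c' b) h) =
    gr_mul (gr_mul (gr_mono c a) (gr_mono c' b)) h.
  rewrite [h]gr_expand !gr_mul_sumr; apply: eq_bigr => d _.
  by rewrite !gr_mul_mono mulrA addrA.
have A2 c a g h : gr_mul (gr_mono c a) (gr_mul g h) =
    gr_mul (gr_mul (gr_mono c a) g) h.
  by rewrite [g]gr_expand !(gr_mul_suml, gr_mul_sumr); apply: eq_bigr.
by move=> f g h; rewrite [f]gr_expand !gr_mul_suml; apply: eq_bigr.
Qed.

Fact gr_mul1 : left_id gr_one gr_mul.
Proof.
move=> f; rewrite (gr_expand f) gr_mul_sumr; apply: eq_bigr => a _.
by rewrite gr_mul_mono mul1r add0r.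
Qed.

Fact gr_one_neq0 : gr_one != 0.
Proof.
apply/eqP => /(congr1 (fun f => gr_coef f 0)).
by rewrite gr_coef0 gr_coef_mono eqxx.
Qed.

HB.instance Definition _ := GRing.Zmodule_isComNzRing.Build {group_ring A}
  gr_mulA gr_mulC gr_mul1 gr_mulDl gr_one_neq0.

End GroupRing.

(* The group Q of monomials x^d is written additively, as Z^k; its group ring
   is Z[x_1^{+-1}, ..., x_k^{+-1}]. *)
Notation expo k := {ffun 'I_k -> int}.
Notation laurent k := {group_ring expo k}.

Section LaurentSize.
Variable k : nat.
Implicit Type g : laurent k.

Definition expo_norm (d : expo k) : nat := (\sum_(i < k) `|d i|%N)%N.

Definition laurent_norm g : nat := (\sum_(d <- gr_supp g) `|gr_coef g d|%N)%N.

Definition laurent_deg g : nat := (\max_(d <- gr_supp g) expo_norm d)%N.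

End LaurentSize.

(* mathcomp's [idealr] only covers proper ideals, whence this structure. *)
Record ideal (R : comNzRingType) := Ideal {
  ideal_set :> set R;
  ideal0 : ideal_set 0;
  idealD : forall u v, ideal_set u -> ideal_set v -> ideal_set (u + v);
  idealM : forall a u, ideal_set u -> ideal_set (a * u) }.

Definition ideal_span (R : comNzRingType) (s : nat) (F : 'I_s -> R) : set R :=
  [set g | exists h : 'I_s -> R, g = \sum_i h i * F i].

Section IdealQuotient.
Variables (R : comNzRingType) (I : ideal R).

Definition ideal_pred : R -> bool := fun x => `[< ideal_set I x >].

Lemma ideal_predP x : (x \in ideal_pred) = `[< ideal_set I x >].
Proof. by []. Qed.

Fact ideal_zmod_closed : zmod_closed ideal_pred.
Proof.
split=> [|u v]; rewrite !ideal_predP; first exact/asboolP/ideal0.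
move=> /asboolP Iu /asboolP Iv; apply/asboolP/idealD => //.
by rewrite -mulN1r; apply: idealM.
Qed.
HB.instance Definition _ := GRing.isZmodClosed.Build R ideal_pred
  ideal_zmod_closed.

Definition ideal_zmod : zmodClosed R := GRing.ZmodClosed.clone R ideal_pred _.

Definition quot_module : Type := Quotient.quot ideal_zmod.

HB.instance Definition _ := GRing.Zmodule.on quot_module.

Definition qm_proj (x : R) : quot_module := \pi_(Quotient.quot ideal_zmod) x.
Definition qm_repr (x : quot_module) : R :=
  repr (x : Quotient.quot ideal_zmod).

Lemma qm_reprK : cancel qm_repr qm_proj.
Proof. by move=> x; rewrite /qm_proj /qm_repr reprK. Qed.

Lemma qm_projP (x y : R) : qm_proj x = qm_proj y <-> ideal_set I (x - y).
Proof.
rewrite /qm_proj; split=> [/eqP|Ixy]; last apply/eqP.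
  by rewrite -Quotient.idealrBE => /asboolP.
by rewrite -Quotient.idealrBE; apply/asboolP.
Qed.

Lemma qm_projD : {morph qm_proj : x y / x + y}.
Proof. exact: Quotient.pi_add. Qed.

Definition qm_scale (a : R) (x : quot_module) : quot_module :=
  qm_proj (a * qm_repr x).

Lemma qm_scaleE a x : qm_scale a (qm_proj x) = qm_proj (a * x).
Proof.
apply/qm_projP; rewrite -mulrBr; apply: idealM.
by apply/qm_projP; rewrite qm_reprK.
Qed.

Fact qm_scaleA a b x : qm_scale a (qm_scale b x) = qm_scale (a * b) x.
Proof. by rewrite -(qm_reprK x) !qm_scaleE mulrA. Qed.
Fact qm_scale1 : left_id 1 qm_scale.
Proof. by move=> x; rewrite -(qm_reprK x) qm_scaleE mul1r. Qed.
Fact qm_scaleDr : right_distributive qm_scale +%R.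
Proof.
move=> a x y; rewrite -(qm_reprK x) -(qm_reprK y).
by rewrite -qm_projD !qm_scaleE -qm_projD mulrDr.
Qed.
Fact qm_scaleDl x : {morph qm_scale^~ x : a b / a + b}.
Proof. by move=> a b; rewrite -(qm_reprK x) !qm_scaleE -qm_projD mulrDl. Qed.

HB.instance Definition _ := GRing.Zmodule_isLmodule.Build R quot_module
  qm_scaleA qm_scale1 qm_scaleDr qm_scaleDl.

Lemma qm_projZ a x : qm_proj (a * x) = a *: qm_proj x.
Proof. by rewrite -qm_scaleE. Qed.

End IdealQuotient.

Section Tame.
Variables (RR : realType) (A : zmodType).

(* The subring Z[A_chi] of Z[A], for A_chi = {a | chi a >= 0}. *)
Definition half_ring (chi : A -> RR) : set {group_ring A} :=
  [set c | forall a, a \in gr_supp c -> 0 <= chi a].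

Definition fg_over (chi : A -> RR) (M : lmodType {group_ring A}) : Prop :=
  exists (r : nat) (e : 'I_r -> M), forall x : M,
    exists c : 'I_r -> {group_ring A},
      (forall i, half_ring chi (c i)) /\ x = \sum_i c i *: e i.

Definition tame (M : lmodType {group_ring A}) : Prop :=
  forall chi : {additive A -> RR},
    fg_over chi M \/ fg_over (fun a => - chi a) M.

End Tame.

Definition tame_ideal (RR : realType) (k : nat) (I : ideal (laurent k)) :=
  tame RR (quot_module I).

Section Complexity.
Variables (k s : nat) (F : 'I_s -> laurent k).

Definition ideal_area (g : laurent k) : nat :=
  least (fun l => exists h : 'I_s -> laurent k,
    g = \sum_i h i * F i /\ l = (\sum_i laurent_norm (h i))%N).

Definition complexity (RR : realType) (I : ideal (laurent k)) (m n : nat) :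
    \bar RR :=
  ereal_sup [set (ideal_area g)%:R%:E | g in
    [set g | ideal_set I g /\ (laurent_norm g <= m)%N /\ (laurent_deg g <= n)%N]].

End Complexity.

Local Open Scope group_scope.

Section Subgroups.
Variable G : groupType.

Definition is_subgroup (H : set G) : Prop :=
  [/\ H 1, forall x y, H x -> H y -> H (x * y) & forall x, H x -> H x^-1].

Definition is_normal (H : set G) : Prop :=
  is_subgroup H /\ forall x y, H x -> H (x ^ y).

Definition generated (A : set G) : set G := smallest is_subgroup A.

Definition derived (A : set G) : set G :=
  generated [set z | exists x y, [/\ A x, A y & z = [~ x, y]]].

Definition metabelian : Prop := derived (derived setT) = [set 1].

Definition finitely_generated : Prop :=
  exists A : seq G, generated [set` A] = setT.

Record normal_subgroup := NormalSubgroup {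
  nsg_set :> set G;
  nsgP : is_normal nsg_set }.

Lemma generated_subgroup A : is_subgroup (generated A).
Proof.
split=> [H [[H1 _ _]] _ //|x y Ax Ay H HH|x Ax H HH].
  have [[_ HM _] _] := HH; by apply: HM; [apply: Ax | apply: Ay].
by have [[_ _ HV] _] := HH; apply: HV; apply: Ax.
Qed.

Lemma subset_generated A : A `<=` generated A.
Proof. by move=> x Ax H [_]; apply. Qed.

Lemma generated_min A H : is_subgroup H -> A `<=` H -> generated A `<=` H.
Proof. by move=> sH sAH x; apply. Qed.

Lemma generated_normal A :
  (forall x y, A x -> A (x ^ y)) -> is_normal (generated A).
Proof.
move=> AJ; split; first exact: generated_subgroup.
move=> x y; have [g1 gM gV] := generated_subgroup A.
apply: (@generated_min _ [set x | generated A (x ^ y)]) => [|z Az].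
  split=> [|u v|u] /=; first by rewrite conj1g.
    by rewrite conjMg; apply: gM.
  by rewrite conjVg; apply: gV.
by apply: subset_generated; apply: AJ.
Qed.

Lemma derived_normal A : is_normal A -> is_normal (derived A).
Proof.
move=> [_ AJ]; apply: generated_normal => _ w [x [y [Ax Ay ->]]].
by exists (x ^ w), (y ^ w); split; rewrite ?conjRg //; apply: AJ.
Qed.

Lemma setT_normal : is_normal setT.
Proof. by split; first split. Qed.

Definition second_derived : normal_subgroup :=
  NormalSubgroup (derived_normal (derived_normal setT_normal)).

Fact normal_closure_subproof (S : set G) : is_normal (smallest is_normal S).
Proof.
split; first split=> [H [[[H1 _ _] _] _] //|x y Ax Ay H HH|x Ax H HH].
- have [[[_ HM _] _] _] := HH; by apply: HM; [apply: Ax | apply: Ay].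
- by have [[[_ _ HV] _] _] := HH; apply: HV; apply: Ax.
by move=> x y Ax H HH; have [[_ HJ] _] := HH; apply: HJ; apply: Ax.
Qed.

Definition normal_closure (S : set G) : normal_subgroup :=
  NormalSubgroup (normal_closure_subproof S).

End Subgroups.

Section QuotientGroup.
Variables (G : groupType) (N : normal_subgroup G).

Definition qg_equiv (x y : G) : bool := `[< nsg_set N (x^-1 * y) >].

Fact qg_equiv_class : equiv_class_of qg_equiv.
Proof.
have [[N1 NM NV] _] := nsgP N.
have sym x y : qg_equiv x y -> qg_equiv y x.
  by move=> /asboolP /NV; rewrite invgM invgK => Nyx; apply/asboolP.
split=> [x|x y|y x z]; first by apply/asboolP; rewrite mulVg.
  by apply/idP/idP; apply: sym.
move=> /asboolP Nxy /asboolP Nyz; apply/asboolP.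
by have := NM _ _ Nxy Nyz; rewrite mulgA mulgK.
Qed.

Canonical qg_equiv_rel := EquivRelPack qg_equiv_class.
Canonical qg_encModRel := defaultEncModRel qg_equiv.

Definition quotient_group : Type := {eq_quot qg_equiv}.

HB.instance Definition _ := Choice.on quotient_group.

Definition qg_proj (x : G) : quotient_group := \pi_({eq_quot qg_equiv}) x.
Definition qg_repr (x : quotient_group) : G := repr (x : {eq_quot qg_equiv}).

Lemma qg_reprK : cancel qg_repr qg_proj.
Proof. by move=> x; rewrite /qg_proj /qg_repr reprK. Qed.

Lemma qg_projP (x y : G) : qg_proj x = qg_proj y <-> nsg_set N (x^-1 * y).
Proof.
rewrite /qg_proj; split=> [/eqP|Nxy]; first by rewrite eqmodE => /asboolP.
by apply/eqP; rewrite eqmodE; apply/asboolP.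
Qed.

Lemma qg_projK x : nsg_set N (x^-1 * qg_repr (qg_proj x)).
Proof. by apply/qg_projP; rewrite qg_reprK. Qed.

Definition qg_one : quotient_group := qg_proj 1.
Definition qg_mul (x y : quotient_group) : quotient_group :=
  qg_proj (qg_repr x * qg_repr y).
Definition qg_inv (x : quotient_group) : quotient_group :=
  qg_proj (qg_repr x)^-1.

Lemma qg_mulE x y : qg_mul (qg_proj x) (qg_proj y) = qg_proj (x * y).
Proof.
have [[N1 NM NV] NJ] := nsgP N; apply/esym/qg_projP.
set x' := qg_repr (qg_proj x); set y' := qg_repr (qg_proj y).
have -> : (x * y)^-1 * (x' * y') = (x^-1 * x') ^ y * (y^-1 * y').
  by rewrite invgM conjgE !mulgA mulgK.
by apply: NM; [apply: NJ|]; apply: qg_projK.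
Qed.

Lemma qg_invE x : qg_inv (qg_proj x) = qg_proj x^-1.
Proof.
have [[N1 NM NV] NJ] := nsgP N; apply/qg_projP.
set x' := qg_repr _; rewrite invgK.
have -> : x' * x^-1 = (x^-1 * x') ^ x^-1.
  by rewrite conjgE invgK !mulgA mulgV mul1g.
exact/NJ/qg_projK.
Qed.

Fact qg_mulA : associative qg_mul.
Proof.
move=> x y z; rewrite -(qg_reprK x) -(qg_reprK y) -(qg_reprK z).
by rewrite !qg_mulE mulgA.
Qed.
Fact qg_mul1 : left_id qg_one qg_mul.
Proof. by move=> x; rewrite -(qg_reprK x) qg_mulE mul1g. Qed.
Fact qg_mulr1 : right_id qg_one qg_mul.
Proof. by move=> x; rewrite -(qg_reprK x) qg_mulE mulg1. Qed.
Fact qg_mulV : left_inverse qg_one qg_inv qg_mul.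
Proof. by move=> x; rewrite -(qg_reprK x) qg_invE qg_mulE mulVg. Qed.
Fact qg_mulrV : right_inverse qg_one qg_inv qg_mul.
Proof. by move=> x; rewrite -(qg_reprK x) qg_invE qg_mulE mulgV. Qed.

HB.instance Definition _ := isGroup.Build quotient_group
  qg_mulA qg_mul1 qg_mulr1 qg_mulV qg_mulrV.

Lemma qg_projM : {morph qg_proj : x y / x * y}.
Proof. by move=> x y; rewrite -qg_mulE. Qed.

Lemma qg_projV : {morph qg_proj : x / x^-1}.
Proof. by move=> x; rewrite -qg_invE. Qed.

End QuotientGroup.

(* A letter (x, false) stands for x and (x, true) for x^-1. *)
Notation letter X := (X * bool)%type.
Notation word X := (seq (letter X)).

Section FreeGroup.
Variable X : choiceType.
Implicit Types (a b : letter X) (u v w : word X).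

Definition letter_inv a : letter X := (a.1, ~~ a.2).

Definition reduced w : bool := sorted (fun a b => b != letter_inv a) w.

Record free_group := FreeGroup { fg_word :> word X; _ : reduced fg_word }.

HB.instance Definition _ := [isSub for fg_word].
HB.instance Definition _ := [Choice of free_group by <:].

(* The reduced form of a w, for w reduced. *)
Definition fg_push a w : word X :=
  if w is b :: w' then if b == letter_inv a then w' else a :: w else [:: a].

Lemma letter_invK : involutive letter_inv.
Proof. by case=> x e; rewrite /letter_inv /= negbK. Qed.

Lemma fg_push_reduced a w : reduced w -> reduced (fg_push a w).
Proof.
case: w => [|b w] //=; case: eqP => [_|/eqP ab] /= bw.
  exact: path_sorted bw.
by rewrite ab.
Qed.

Lemma fg_pushK a w : reduced w -> fg_push a (fg_push (letter_inv a) w) = w.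
Proof.
case: w => [|b w] /=; first by rewrite eqxx.
rewrite letter_invK; case: (eqVneq b a) => [-> |ba _] /=; last first.
  by rewrite eqxx.
by case: w => [|c w] //= /andP[/negbTE ->].
Qed.

Lemma fg_foldr_reduced u w : reduced w -> reduced (foldr fg_push w u).
Proof. by move=> rw; elim: u => //= a u; apply: fg_push_reduced. Qed.

Lemma fg_foldr_id w : reduced w -> foldr fg_push [::] w = w.
Proof.
elim: w => //= a w IH aw; rewrite IH; last exact: path_sorted aw.
by case: w aw {IH} => [|b w] //= /andP[/negbTE ->].
Qed.

Lemma fg_foldr_push a u w : reduced w ->
  foldr fg_push w (fg_push a u) = fg_push a (foldr fg_push w u).
Proof.
move=> rw; case: u => [|b u] //=; case: eqP => [->|_] //=.
by rewrite fg_pushK //; apply: fg_foldr_reduced.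
Qed.

Definition fg_one : free_group := @FreeGroup [::] isT.
Definition fg_mul (u v : free_group) : free_group :=
  FreeGroup (fg_foldr_reduced u (valP v)).

Fact fg_inv_reduced (u : free_group) : reduced (rev (map letter_inv u)).
Proof.
rewrite /reduced rev_sorted sorted_map.
apply: sub_sorted (valP u) => a b /=; apply: contraNN => /eqP.
by rewrite letter_invK => ->.
Qed.
Definition fg_inv (u : free_group) : free_group :=
  FreeGroup (fg_inv_reduced u).

Fact fg_mulA : associative fg_mul.
Proof.
move=> u v w; apply: val_inj => /=; elim: (fg_word u) => //= a u' ->.
by rewrite fg_foldr_push //; apply: valP.
Qed.
Fact fg_mul1 : left_id fg_one fg_mul.
Proof. by move=> u; apply: val_inj. Qed.
Fact fg_mulr1 : right_id fg_one fg_mul.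
Proof. by move=> u; apply: val_inj; apply: fg_foldr_id; apply: valP. Qed.
Fact fg_mulV : left_inverse fg_one fg_inv fg_mul.
Proof.
move=> u; apply: val_inj => /=; elim: (fg_word u) => //= a u' IH.
by rewrite rev_cons -cats1 foldr_cat /= letter_invK eqxx.
Qed.
Fact fg_mulrV : right_inverse fg_one fg_inv fg_mul.
Proof.
move=> u; suff uE : fg_inv (fg_inv u) = u by rewrite -{1}uE fg_mulV.
apply: val_inj; rewrite /= map_rev revK -map_comp.
by rewrite map_id_in // => a _; rewrite /= letter_invK.
Qed.

HB.instance Definition _ := isGroup.Build free_group
  fg_mulA fg_mul1 fg_mulr1 fg_mulV fg_mulrV.

Definition fg_gen (x : X) : free_group := @FreeGroup [:: (x, false)] isT.

(* F(X) / F(X)'' *)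
Definition free_metabelian : groupType :=
  quotient_group (second_derived free_group).

Definition fm_gen (x : X) : free_metabelian := qg_proj _ (fg_gen x).

End FreeGroup.

Definition word_eval (X : Type) (H : groupType) (f : X -> H) (w : word X) : H :=
  \prod_(a <- w) (if a.2 then (f a.1)^-1 else f a.1).

(* A choice, for every finite set X, of an "ambient" group on X in which the
   relators live: F(X) for ordinary presentations, and the free metabelian
   group on X for presentations relative to the metabelian variety. *)
Record ambient := Ambient {
  amb_group :> finType -> groupType;
  amb_gen : forall X : finType, X -> amb_group X }.

Definition absolute_ambient : ambient := Ambient (fun X : finType => @fg_gen X).
Definition metabelian_ambient : ambient :=
  Ambient (fun X : finType => @fm_gen X).

Record presentation (V : ambient) (G : groupType) := Presentation {
  pres_gens : finType;
  pres_rels : seq (V pres_gens);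
  pres_iso : {multiplicative
                quotient_group (normal_closure [set` pres_rels]) -> G};
  pres_iso_bij : bijective pres_iso }.

Section Dehn.
Variables (V : ambient) (G : groupType) (P : presentation V G).
Local Notation X := (pres_gens P).
Local Notation S := (pres_rels P).

Definition word_amb (w : word X) : V X := word_eval (@amb_gen V X) w.

Definition word_group (w : word X) : G := pres_iso P (qg_proj _ (word_amb w)).

Definition word_area (w : word X) : nat :=
  least (fun l => exists u r : 'I_l -> V X,
    (forall i, r i \in S \/ (r i)^-1 \in S) /\
    word_amb w = \prod_(i < l) ((u i)^-1 * r i * u i)).

Definition dehn (RR : realType) (t : RR) : \bar RR :=
  ereal_sup [set (word_area w)%:R%:E | w in
    [set w : word X | word_group w = 1 /\ ((size w)%:R <= t)%R]].

End Dehn.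

(* Main.v *)
(* G_I is the semidirect product (R/I) x| Q, generated by a = 1 and x_1, ..., x_k,
   with the relators [x_i, x_j], some [a, a^d] and words for the f_j (plus, in the
   tame case, some other elements of I). The free group maps onto R x| Q, every
   relator going to an element of I of bounded area; so a word of length at most
   m(2n+1) that spells g out of conjugates of a cannot have a smaller area than g,
   up to a constant.
   That these relators present G_I amounts to all conjugates of a commuting. In the
   metabelian variety [a, a^(x_i)] = 1 is enough. For a tame I, as Bieri and Strebel
   discovered, each character is positive or negative on the support of some lambda
   in 1 + I; by compactness of the sphere of characters, finitely many lambda serve
   all characters. The relation a = a^lambda expresses a, for every q outside some
   ball, by conjugates a^u such that all q + u (or all q - u) are shorter than q,
   whence [a, a^q] = 1 by induction on |q|. *)

Require Import Defs.
From HB Require Import structures.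
From mathcomp Require Import all_boot all_order all_algebra finmap.
From mathcomp Require Import boolp classical_sets reals constructive_ereal ereal.
From mathcomp Require Import topology normedtype.
From mathcomp Require Import zify ring lra.

Set Implicit Arguments.
Unset Strict Implicit.
Unset Printing Implicit Defensive.

Import Order.TTheory GRing.Theory Num.Theory.
Import numFieldNormedType.Exports.

Local Open Scope classical_set_scope.
Local Open Scope ring_scope.

(** * Words in commuting letters *)

Section GroupMorphisms.
Local Open Scope group_scope.
Variables (G H : groupType) (phi : G -> H).
Hypothesis phiM : {morph phi : x y / x * y}.

Lemma group_morph1 : phi 1 = 1.
Proof. by apply: (mulgI (phi 1)); rewrite -phiM !mulg1. Qed.

Lemma group_morphV x : phi x^-1 = (phi x)^-1.
Proof. by apply: (mulgI (phi x)); rewrite -phiM !mulgV group_morph1. Qed.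

Lemma group_morphJ x y : phi (x ^ y) = phi x ^ phi y.
Proof. by rewrite !conjgE !phiM group_morphV. Qed.

Lemma group_morphR x y : phi [~ x, y] = [~ phi x, phi y].
Proof. by rewrite !commgEl phiM group_morphV group_morphJ. Qed.

Lemma is_normal_ker : is_normal [set x | phi x = 1]%classic.
Proof.
split; last by move=> x y /= x1; rewrite group_morphJ x1 conj1g.
split=> /= [|x y x1 y1|x x1]; first exact: group_morph1.
  by rewrite phiM x1 y1 mulg1.
by rewrite group_morphV x1 invg1.
Qed.

End GroupMorphisms.

Section WordEval.
Variables (X : Type) (H : groupType).
Implicit Types (f : X -> H) (v w : word X).
Local Open Scope group_scope.

Lemma word_eval_nil f : word_eval f [::] = 1.
Proof. exact: big_nil. Qed.

Lemma word_eval_cons f a w :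
  word_eval f (a :: w) = (if a.2 then (f a.1)^-1 else f a.1) * word_eval f w.
Proof. exact: big_cons. Qed.

Lemma word_eval_cat f v w :
  word_eval f (v ++ w) = word_eval f v * word_eval f w.
Proof. exact: big_cat. Qed.

Lemma eq_word_eval f g w : f =1 g -> word_eval f w = word_eval g w.
Proof. by move=> fg; apply: eq_bigr => a _; rewrite fg. Qed.

Lemma word_eval_map (Y : Type) (h : Y -> X) f (w : word Y) :
  word_eval f [seq (h a.1, a.2) | a <- w] = word_eval (f \o h) w.
Proof. exact: big_map. Qed.

Lemma word_eval_flatten (T : Type) f (ws : T -> word X) (s : seq T) :
  word_eval f (flatten [seq ws x | x <- s]) = \prod_(x <- s) word_eval f (ws x).
Proof.
elim: s => [|x s IH]; first by rewrite word_eval_nil big_nil.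
by rewrite big_cons /= word_eval_cat IH.
Qed.

Lemma word_eval_conj f w y :
  (word_eval f w) ^ y = word_eval (fun x => (f x) ^ y) w.
Proof.
rewrite /word_eval conjg_prod; apply: eq_bigr => a _.
by case: a.2; rewrite ?conjVg.
Qed.

Lemma morph_word_eval (K : groupType) (phi : H -> K) f w :
  {morph phi : x y / x * y} -> phi (word_eval f w) = word_eval (phi \o f) w.
Proof.
move=> phiM.
rewrite /word_eval (big_morph phi phiM (group_morph1 phiM)).
by apply: eq_bigr => a _ /=; case: a.2; rewrite ?(group_morphV phiM).
Qed.

Lemma commute_word_eval f w y :
  (forall a, List.In a w -> commute y (f a.1)) -> commute y (word_eval f w).
Proof.
elim: w => [|a w IH] yw; first by rewrite word_eval_nil; apply: commute1.
rewrite word_eval_cons; apply: commuteM; last first.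
  by apply: IH => b bw; apply: yw; right.
have ya : commute y (f a.1) by apply: yw; left.
by case: a.2 => //; apply: commuteV.
Qed.

End WordEval.

Section NetExponent.
Variable X : choiceType.
Implicit Types (x : X) (v w : word X).

Definition word_inv w : word X := rev [seq letter_inv a | a <- w].

Definition word_exp w x : int :=
  (count_mem (x, false) w)%:Z - (count_mem (x, true) w)%:Z.

Definition exp_word (f : X -> int) (r : seq X) : word X :=
  flatten [seq nseq `|f x|%N (x, f x < 0) | x <- r].

Lemma word_eval_inv (H : groupType) (f : X -> H) w :
  word_eval f (word_inv w) = ((word_eval f w)^-1)%g.
Proof.
elim: w => [|a w IH]; first by rewrite !word_eval_nil invg1.
rewrite /word_inv map_cons rev_cons -cats1 word_eval_cat IH.
rewrite !word_eval_cons word_eval_nil mulg1 invgM /=.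
by case: a.2 => /=; rewrite ?invgK.
Qed.

Lemma size_word_inv w : size (word_inv w) = size w.
Proof. by rewrite size_rev size_map. Qed.

Lemma word_exp_cat v w x : word_exp (v ++ w) x = word_exp v x + word_exp w x.
Proof. by rewrite /word_exp !count_cat; lia. Qed.

Lemma word_exp_cons a w x : word_exp (a :: w) x =
  (if a.2 then - 1 else 1) *+ (a.1 == x) + word_exp w x.
Proof.
case: a => y e; rewrite /word_exp /= !xpair_eqE.
by case: (y == x); case: e => /=; lia.
Qed.

Lemma word_exp_inv w x : word_exp (word_inv w) x = - word_exp w x.
Proof.
rewrite /word_exp /word_inv !count_rev !count_map.
have e b : preim (@letter_inv X) (pred1 (x, b)) =1 pred1 (x, ~~ b).
  by case=> y c; rewrite /= /letter_inv !xpair_eqE /=; case: b; case: c.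
by rewrite !(eq_count (e _)) /=; lia.
Qed.

Lemma word_exp_nseq x n b y :
  word_exp (nseq n (x, b)) y = (if b then - n%:Z else n%:Z) *+ (x == y).
Proof.
elim: n => [|n IHn]; first by case: b; rewrite ?oppr0 mul0rn.
rewrite word_exp_cons IHn /=.
by case: (x == y); case: (b); rewrite ?mulr1n ?mulr0n; lia.
Qed.

Lemma word_exp_exp_word f r x :
  uniq r -> word_exp (exp_word f r) x = f x *+ (x \in r).
Proof.
elim: r => [|y r IH] //= /andP[yr ur].
rewrite [exp_word _ _]/(_ ++ exp_word f r) word_exp_cat IH //.
rewrite word_exp_nseq in_cons eq_sym; case: eqP => [->|_]; last by rewrite add0r.
rewrite (negbTE yr) addr0 /= !mulr1n.
by case: ifP; lia.
Qed.

Lemma mem_exp_word f r a : a \in exp_word f r -> a.1 \in r /\ f a.1 != 0.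
Proof.
case/flattenP => _ /mapP[x xr ->]; rewrite mem_nseq => /andP[fx /eqP->] /=.
by rewrite -absz_gt0.
Qed.

Lemma size_exp_word f r : size (exp_word f r) = (\sum_(x <- r) `|f x|)%N.
Proof.
rewrite /exp_word size_flatten /shape -map_comp sumnE big_map.
by apply: eq_bigr => x _ /=; rewrite size_nseq.
Qed.

Section Commuting.
Variables (H : groupType) (f : X -> H).
Hypothesis fC : forall x y, commute (f x) (f y).

(* A word with zero exponents contains the inverse of its first letter, with
   which that letter cancels. *)
Lemma word_eval_exp0 w : (forall x, word_exp w x = 0) -> word_eval f w = 1%g.
Proof.
elim: {w}(size w).+1 {-2}w (ltnSn (size w)) => // n IH [|a w] ltn w0.
  exact: word_eval_nil.
have aw : letter_inv a \in w.
  have := w0 a.1; case: a {w0 ltn} => x e.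
  rewrite -has_pred1 has_count /word_exp /= !xpair_eqE !eqxx /=.
  by case: e => /=; rewrite /letter_inv /= => ?; lia.
case/splitPr: aw ltn w0 => w1 w2 ltn w0.
have e12 : word_eval f (a :: w1 ++ letter_inv a :: w2) = word_eval f (w1 ++ w2).
  rewrite word_eval_cons !word_eval_cat word_eval_cons mulgA.
  set fa := if a.2 then _ else _; have -> : (if (letter_inv a).2 then
     (f (letter_inv a).1)^-1 else f (letter_inv a).1)%g = (fa^-1)%g.
    by rewrite /fa /=; case: a.2 => /=; rewrite ?invgK.
  have Cfa : commute fa (word_eval f w1).
    apply/commute_sym; rewrite /fa.
    have : commute (word_eval f w1) (f a.1).
      by apply/commute_sym/commute_word_eval.
    by case: a.2 => // /commuteV.
  by rewrite Cfa -mulgA mulVKg.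
rewrite e12; apply: IH => [|x].
  by move: ltn; rewrite /= !size_cat /=; lia.
move: (w0 x); rewrite word_exp_cons !word_exp_cat word_exp_cons /=.
by case: a.2 => /=; lia.
Qed.

Lemma eq_word_exp_eval v w :
  (forall x, word_exp v x = word_exp w x) -> word_eval f v = word_eval f w.
Proof.
move=> vw; apply: divg1_eq; rewrite -word_eval_inv -word_eval_cat.
by apply: word_eval_exp0 => x; rewrite word_exp_cat word_exp_inv vw subrr.
Qed.

End Commuting.
End NetExponent.

(** * Group rings and semidirect products *)

Section GroupRingWords.
Variable A : zmodType.
Implicit Types (d e : A) (s : word A) (g : {group_ring A}).

Lemma gr_coefM_mono c d g e : gr_coef (gr_mono c d * g) e = c * gr_coef g (e - d).
Proof.
have -> : gr_mono c d * g = \sum_(b <- gr_supp g) gr_mono (c * gr_coef g b) (d + b).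
  by rewrite {1}[g]gr_expand mulr_sumr; apply: eq_bigr => b _; apply: gr_mul_mono.
rewrite [in RHS](gr_expand g) !gr_coef_sum mulr_sumr; apply: eq_bigr => b _.
rewrite !gr_coef_mono mulrnAr; congr (_ *+ nat_of_bool _).
by rewrite [RHS]eq_sym subr_eq eq_sym addrC.
Qed.

Lemma gr_monoM c c' d e :
  gr_mono c d * gr_mono c' e = gr_mono (c * c') (d + e) :> {group_ring A}.
Proof. exact: gr_mul_mono. Qed.

(** In a word over A the letter d stands for the conjugate of a by x^d, so [lval] is the group ring
    element that such a word gives to a as an exponent. *)
Definition lval s : {group_ring A} :=
  \sum_(a <- s) gr_mono (if a.2 then - 1 else 1) a.1.

Lemma lval_nil : lval [::] = 0.
Proof. exact: big_nil. Qed.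

Lemma lval_cons a s :
  lval (a :: s) = gr_mono (if a.2 then - 1 else 1) a.1 + lval s.
Proof. exact: big_cons. Qed.

Lemma lval_cat s s' : lval (s ++ s') = lval s + lval s'.
Proof. exact: big_cat. Qed.

Lemma gr_coef_lval s d : gr_coef (lval s) d = word_exp s d.
Proof.
elim: s => [|a s IH]; first by rewrite lval_nil gr_coef0.
by rewrite lval_cons word_exp_cons gr_coefD gr_coef_mono IH.
Qed.

Lemma lval_inv s : lval (word_inv s) = - lval s.
Proof.
by apply: gr_ext => d; rewrite gr_coefN !gr_coef_lval word_exp_inv.
Qed.

Definition word_shift e s : word A := [seq (a.1 + e, a.2) | a <- s].

Lemma lval_shift e s : lval (word_shift e s) = gr_mono 1 e * lval s.
Proof.
rewrite /lval big_map mulr_sumr; apply: eq_bigr => a _.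
by rewrite gr_monoM mul1r addrC.
Qed.

Definition gr_word g : word A := exp_word (gr_coef g) (gr_supp g).

Lemma gr_wordK g : lval (gr_word g) = g.
Proof.
apply: gr_ext => d; rewrite gr_coef_lval word_exp_exp_word ?fset_uniq //.
by case: (boolP (d \in _)) => [|/gr_out ->].
Qed.

Lemma gr_supp_gr_word g a : a \in gr_word g -> a.1 \in gr_supp g.
Proof. by case/mem_exp_word. Qed.

(** Built from translates of [s'] and their inverses, and not only from the value of the product, so
    that it is trivial in every group with commuting x_i in which [s'] is. *)
Definition word_scale s s' : word A :=
  flatten [seq if a.2 then word_inv (word_shift a.1 s') else word_shift a.1 s'
          | a <- s].

Lemma lval_scale s s' : lval (word_scale s s') = lval s * lval s'.
Proof.
elim: s => [|a s IH]; first by rewrite lval_nil mul0r.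
rewrite lval_cons mulrDl -IH [word_scale _ _]/(_ ++ word_scale s s') lval_cat.
congr (_ + _); case: a.2; rewrite ?lval_inv lval_shift // -mulNr; congr (_ * _).
by apply: gr_ext => b; rewrite gr_coefN !gr_coef_mono mulNrn.
Qed.

End GroupRingWords.

Definition sdp (A : zmodType) (M : lmodType {group_ring A}) : Type := (A * M)%type.

Section SemidirectProduct.
Variables (A : zmodType) (M : lmodType {group_ring A}).

HB.instance Definition _ := Choice.on (sdp M).

Implicit Types x y z : sdp M.

(* (d, m) stands for the product x^d m, and m x^e = x^e (x^e . m), so that
   m ^ x^e is the action of x^e on m. *)
Definition sdp_mul x y : sdp M := (x.1 + y.1, gr_mono 1 y.1 *: x.2 + y.2).
Definition sdp_one : sdp M := (0, 0).
Definition sdp_inv x : sdp M := (- x.1, - (gr_mono 1 (- x.1) *: x.2)).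

Fact sdp_mulA : associative sdp_mul.
Proof.
move=> x y z; rewrite /sdp_mul /= addrA; congr (_, _).
by rewrite scalerDr scalerA gr_monoM mulr1 (addrC z.1) addrA.
Qed.
Fact sdp_mul1 : left_id sdp_one sdp_mul.
Proof. by case=> d m; rewrite /sdp_mul /= scaler0 !add0r. Qed.
Fact sdp_mulr1 : right_id sdp_one sdp_mul.
Proof. by case=> d m; rewrite /sdp_mul /= scale1r !addr0. Qed.
Fact sdp_mulV : left_inverse sdp_one sdp_inv sdp_mul.
Proof.
case=> d m; rewrite /sdp_mul /= addNr scalerN scalerA gr_monoM subrr mulr1.
by rewrite scale1r addNr.
Qed.
Fact sdp_mulrV : right_inverse sdp_one sdp_inv sdp_mul.
Proof. by case=> d m; rewrite /sdp_mul /= !subrr. Qed.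

HB.instance Definition _ := isGroup.Build (sdp M)
  sdp_mulA sdp_mul1 sdp_mulr1 sdp_mulV sdp_mulrV.

Definition sdp_inj (m : M) : sdp M := (0, m).

Local Open Scope group_scope.

Lemma sdpM x y : x * y = (x.1 + y.1, gr_mono 1 y.1 *: x.2 + y.2)%R.
Proof. by []. Qed.

Lemma sdpV x : x^-1 = (- x.1, - (gr_mono 1 (- x.1) *: x.2))%R.
Proof. by []. Qed.

Lemma sdp_injJ m x : (sdp_inj m) ^ x = sdp_inj (gr_mono 1%R x.1 *: m).
Proof.
case: x => d n; rewrite conjgE !sdpM sdpV /=; congr (_, _).
  by rewrite add0r addNr.
rewrite scalerN scalerA gr_monoM add0r addrN mulr1 scale1r.
by rewrite addrCA addNr addr0.
Qed.

Lemma sdp_injM m n : sdp_inj m * sdp_inj n = sdp_inj (m + n).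
Proof. by rewrite sdpM /= addr0 scale1r. Qed.

Lemma sdp_injV m : (sdp_inj m)^-1 = sdp_inj (- m).
Proof. by rewrite sdpV /= oppr0 scale1r. Qed.

Lemma sdp_injE x : x.1 = 0%R -> x = sdp_inj x.2.
Proof. by case: x => d m /= ->. Qed.

Lemma sdp_commg1 x y : [~ x, y].1 = 0%R.
Proof. by rewrite commgEl conjgE !sdpM !sdpV /= (addrC x.1) addKr addNr. Qed.

Lemma sdp_commute0 x y : x.1 = 0%R -> y.1 = 0%R -> commute x y.
Proof.
move=> /sdp_injE -> /sdp_injE ->.
by rewrite /commute !sdp_injM addrC.
Qed.

Lemma sdp_base_subgroup : is_subgroup [set x : sdp M | x.1 = 0%R].
Proof.
split=> //= [x y x0 y0|x x0]; first by rewrite x0 y0 addr0.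
by rewrite x0 oppr0.
Qed.

Lemma sdp_derived_base x : derived setT x -> x.1 = 0%R.
Proof.
apply: (generated_min sdp_base_subgroup) => _ [y [z [_ _ ->]]].
exact: sdp_commg1.
Qed.

Lemma sdp_metabelian : metabelian (sdp M).
Proof.
apply/seteqP; split=> [x|_ ->]; last by have [] := nsgP (second_derived (sdp M)) => -[].
apply: generated_min.
  by split=> //= [y z -> ->|y ->]; rewrite ?mulg1 ?invg1.
move=> _ [y [z [/sdp_derived_base y0 /sdp_derived_base z0 ->]]].
exact/eqP/commgP/sdp_commute0.
Qed.

Lemma sdp_word_eval0 (X : Type) (f : X -> M) (w : word X) :
  word_eval (fun i => sdp_inj (f i)) w =
    sdp_inj (\sum_(a <- w) (if a.2 then - f a.1 else f a.1))%R.
Proof.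
elim: w => [|a w IH]; first by rewrite word_eval_nil big_nil.
rewrite word_eval_cons IH big_cons -sdp_injM; congr (_ * _).
by case: a.2 => //; rewrite sdp_injV.
Qed.

End SemidirectProduct.

(** * Areas of elements of an ideal *)

Section IdealArea.
Variables (k s : nat) (F : 'I_s -> laurent k).
Implicit Types (g h : laurent k).

(** The relational form of the area: such bounds add up along a product of relators without a
    minimum being computed. *)
Definition area_le g (n : nat) := exists h : 'I_s -> laurent k,
  g = \sum_i h i * F i /\ (\sum_i laurent_norm (h i) <= n)%N.

Lemma laurent_norm_sub (D : {fset expo k}) g : (gr_supp g `<=` D)%fset ->
  laurent_norm g = (\sum_(d <- D) `|gr_coef g d|)%N.
Proof.
by move=> gD; apply: big_fset_incl => // d _ /gr_out ->.
Qed.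

Lemma laurent_normD g h : (laurent_norm (g + h)%R <= laurent_norm g + laurent_norm h)%N.
Proof.
rewrite (laurent_norm_sub (gr_suppD g h)).
rewrite (laurent_norm_sub (fsubsetUl _ (gr_supp h))).
rewrite (laurent_norm_sub (fsubsetUr (gr_supp g) _)) -big_split /=.
by apply: leq_sum => d _; rewrite gr_coefD; lia.
Qed.

Lemma laurent_norm0 : laurent_norm (0 : laurent k) = 0%N.
Proof. by rewrite /laurent_norm big1 // => d _; rewrite gr_coef0. Qed.

Lemma laurent_norm_word (w : word (expo k)) : (laurent_norm (lval w) <= size w)%N.
Proof.
elim: w => [|a w IH]; first by rewrite lval_nil laurent_norm0.
rewrite lval_cons; apply: leq_trans (laurent_normD _ _) _.
rewrite -[size _]add1n; apply: leq_add => //.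
rewrite (laurent_norm_sub (gr_supp_mono _ _)) big_seq_fset1 gr_coef_mono eqxx.
by case: a.2.
Qed.

Lemma size_gr_word g : size (gr_word g) = laurent_norm g.
Proof. exact: size_exp_word. Qed.

Lemma laurent_norm_unit d (e : bool) g :
  (laurent_norm (gr_mono (if e then -1 else 1) d * g)%R <= laurent_norm g)%N.
Proof.
have -> : gr_mono (if e then -1 else 1) d * g = lval (word_scale [:: (d, e)] (gr_word g)).
  by rewrite lval_scale gr_wordK lval_cons lval_nil addr0.
apply: leq_trans (laurent_norm_word _) _; rewrite -size_gr_word /word_scale /= cats0.
by case: e; rewrite ?size_word_inv size_map.
Qed.

Lemma area_le0 : area_le 0 0.
Proof.
exists (fun=> 0); split; last by rewrite big1 // => i _; rewrite laurent_norm0.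
by rewrite big1 // => i _; rewrite mul0r.
Qed.

Lemma area_leD g h m n : area_le g m -> area_le h n -> area_le (g + h) (m + n).
Proof.
case=> u [-> um] [v [-> vn]]; exists (fun i => u i + v i); split.
  by rewrite -big_split; apply: eq_bigr => i _; rewrite mulrDl.
apply: leq_trans (leq_add um vn); rewrite -big_split.
by apply: leq_sum => i _; apply: laurent_normD.
Qed.

(** Conjugating or inverting a relator does this to its image in R, so neither costs area. *)
Lemma area_le_unit d (e : bool) g m :
  area_le g m -> area_le (gr_mono (if e then -1 else 1) d * g) m.
Proof.
case=> u [-> um]; exists (fun i => gr_mono (if e then -1 else 1) d * u i); split.
  by rewrite mulr_sumr; apply: eq_bigr => i _; rewrite mulrA.
by apply: leq_trans um; apply: leq_sum => i _; apply: laurent_norm_unit.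
Qed.

Lemma area_leW g m n : (m <= n)%N -> area_le g m -> area_le g n.
Proof. by move=> mn [h [-> hm]]; exists h; split => //; apply: leq_trans mn. Qed.

Lemma area_le_gen i : area_le (F i) 1.
Proof.
exists (fun j => gr_mono (i == j)%:Z 0); split.
  rewrite (bigD1 i) //= eqxx mul1r big1 ?addr0 // => j /negbTE.
  by rewrite eq_sym => ->; rewrite gr_mono0 mul0r.
rewrite (bigD1 i) //= eqxx big1 => [|j /negbTE]; last first.
  by rewrite eq_sym => ->; rewrite gr_mono0 laurent_norm0.
by rewrite addn0 (laurent_norm_sub (gr_supp_mono _ _)) big_seq_fset1 gr_coef_mono eqxx.
Qed.

Lemma ideal_area_le g n : area_le g n -> (ideal_area F g <= n)%N.
Proof.
case=> h [gh hn]; apply: leq_trans hn; rewrite /ideal_area.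
set P := fun l => _; suff Pl : P (\sum_i laurent_norm (h i))%N.
  by have [] := leastP Pl.
by exists h.
Qed.

Lemma area_le_span g : ideal_span F g -> exists n, area_le g n.
Proof. by case=> h gh; exists (\sum_i laurent_norm (h i))%N, h. Qed.

End IdealArea.

(** * Conjugate words and presentations *)

Section ConjugateWords.
Variable k : nat.
Implicit Types (d e : expo k) (s : word (expo k)).

(* [None] is the letter a, and [Some i] the letter x_i. *)
Local Notation gens := (option 'I_k).

Definition mono_word d : word gens :=
  [seq (Some a.1, a.2) | a <- exp_word d (enum 'I_k)].

Definition conj_word s : word gens :=
  flatten [seq word_inv (mono_word a.1) ++ (None, a.2) :: mono_word a.1 | a <- s].

Lemma size_mono_word d : size (mono_word d) = expo_norm d.
Proof. by rewrite size_map size_exp_word big_enum. Qed.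

(** Each letter becomes a conjugate of a or its inverse by a word of length at most n, which takes
    at most 2n + 1 letters. *)
Lemma size_conj_word s n : (forall a, a \in s -> (expo_norm a.1 <= n)%N) ->
  (size (conj_word s) <= size s * n.*2.+1)%N.
Proof.
elim: s => //= a s IH sn; rewrite [conj_word _]/(_ ++ conj_word s) size_cat.
rewrite mulSn leq_add //; last by apply: IH => b bs; rewrite sn ?in_cons ?bs ?orbT.
have := sn a (mem_head _ _); rewrite size_cat /= size_word_inv size_mono_word.
lia.
Qed.

Definition expo_unit (i : 'I_k) : expo k := [ffun j => (i == j)%:Z].

Section Eval.
Local Open Scope group_scope.
Variables (H : groupType) (f : gens -> H).

Definition tpow d : H := word_eval f (mono_word d).

Definition aconj d : H := f None ^ tpow d.

Lemma word_eval_conj_word s : word_eval f (conj_word s) = word_eval aconj s.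
Proof.
elim: s => [|a s IH]; first by rewrite !word_eval_nil.
rewrite word_eval_cons -IH [conj_word _]/(_ ++ conj_word s) word_eval_cat.
congr (_ * _); rewrite word_eval_cat word_eval_inv word_eval_cons /aconj /tpow /=.
by case: a.2; rewrite -?conjVg conjgE.
Qed.

Hypothesis tC : forall i j, commute (f (Some i)) (f (Some j)).

Lemma tpowE (w : word 'I_k) d : (forall i, word_exp w i = d i) ->
  word_eval (f \o Some) w = tpow d.
Proof.
move=> wd; rewrite /tpow word_eval_map; apply: eq_word_exp_eval => [i j|i] /=.
  exact: tC.
by rewrite wd word_exp_exp_word ?enum_uniq // mem_enum mulr1n.
Qed.

Lemma tpowD d e : tpow (d + e)%R = tpow d * tpow e.
Proof.
rewrite {2 3}/tpow /mono_word !word_eval_map -word_eval_cat; apply/esym/tpowE => i.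
by rewrite word_exp_cat !word_exp_exp_word ?enum_uniq // mem_enum ffunE.
Qed.

Lemma tpow0 : tpow 0%R = 1.
Proof.
rewrite -(word_eval_nil (f \o Some)); apply/esym/tpowE => i.
by rewrite ffunE.
Qed.

Lemma tpowV d : tpow (- d)%R = (tpow d)^-1.
Proof. by apply/esym/mulg1_eq; rewrite -tpowD subrr tpow0. Qed.

Lemma tpow_unit i : tpow (expo_unit i) = f (Some i).
Proof.
have <- : word_eval (f \o Some) [:: (i, false)] = f (Some i).
  by rewrite word_eval_cons word_eval_nil mulg1.
by apply/esym/tpowE => j; rewrite word_exp_cons ffunE /=; case: (i == j).
Qed.

Lemma aconj0 : aconj 0%R = f None.
Proof. by rewrite /aconj tpow0 conjg1. Qed.

Lemma aconjJ d e : (aconj d) ^ (tpow e) = aconj (d + e)%R.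
Proof. by rewrite /aconj -conjgM tpowD. Qed.

Lemma word_eval_shift e s :
  word_eval aconj (word_shift e s) = (word_eval aconj s) ^ (tpow e).
Proof.
rewrite /word_shift (word_eval_map (fun d => d + e)%R) word_eval_conj.
by apply: eq_word_eval => d /=; rewrite aconjJ.
Qed.

(** Conjugation by x^d carries a and its conjugate by x^(e - d) to the given pair, so it is enough
    to know what commutes with a. *)
Lemma commute_aconj d e : commute (f None) (aconj (e - d)%R) ->
  commute (aconj d) (aconj e).
Proof.
move=> C; have -> : aconj e = aconj (e - d)%R ^ tpow d by rewrite aconjJ subrK.
by rewrite {1}/aconj /commute -!conjMg C.
Qed.

Lemma word_eval_scale s s' : word_eval aconj s' = 1 ->
  word_eval aconj (word_scale s s') = 1.
Proof.
move=> s'1; elim: s => [|a s IH]; first exact: word_eval_nil.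
rewrite [word_scale _ _]/(_ ++ word_scale s s') word_eval_cat IH mulg1.
by case: a.2; rewrite ?word_eval_inv word_eval_shift s'1 conj1g ?invg1.
Qed.

End Eval.

Section SemidirectWords.
Variables (M : lmodType (laurent k)) (m : M).

Definition sdp_gen (x : gens) : sdp M :=
  if x is Some i then (expo_unit i, 0) else sdp_inj m.

Lemma sdp_tC i j : commute (sdp_gen (Some i)) (sdp_gen (Some j)).
Proof. by rewrite /commute !sdpM /= addrC !scaler0. Qed.

Lemma sdp_tpow d : tpow sdp_gen d = (d, 0).
Proof.
rewrite /tpow word_eval_map.
have E (w : word 'I_k) : word_eval (sdp_gen \o Some) w = ([ffun i => word_exp w i], 0).
  elim: w => [|a w IH].
    by rewrite word_eval_nil; congr (_, _); apply/ffunP => i; rewrite !ffunE.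
  rewrite word_eval_cons IH; case: a => i [] /=.
    rewrite sdpV sdpM /= !scaler0 oppr0 scaler0 addr0; congr (_, _).
    by apply/ffunP => j; rewrite !ffunE word_exp_cons /=; case: (i == j).
  rewrite sdpM /= !scaler0 addr0; congr (_, _).
  by apply/ffunP => j; rewrite !ffunE word_exp_cons /=; case: (i == j).
rewrite E; congr (_, _); apply/ffunP => i.
by rewrite ffunE word_exp_exp_word ?enum_uniq // mem_enum.
Qed.

Lemma sdp_aconj d : aconj sdp_gen d = sdp_inj (gr_mono 1 d *: m).
Proof. by rewrite /aconj sdp_tpow sdp_injJ. Qed.

Lemma sdp_conj_word s :
  word_eval sdp_gen (conj_word s) = sdp_inj (lval s *: m).
Proof.
rewrite word_eval_conj_word (eq_word_eval _ sdp_aconj) sdp_word_eval0.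
congr sdp_inj; rewrite scaler_suml; apply: eq_bigr => a _.
case: a.2 => //; rewrite -scaleNr; congr (_ *: _).
by apply: gr_ext => d; rewrite gr_coefN !gr_coef_mono mulNrn.
Qed.

End SemidirectWords.

Section Relators.
Variables (B : seq (expo k)) (E : seq (word (expo k))).

Definition comm_word (v w : word gens) : word gens :=
  word_inv v ++ word_inv w ++ v ++ w.

Lemma word_eval_comm (H : groupType) (f : gens -> H) v w :
  word_eval f (comm_word v w) = [~ word_eval f v, word_eval f w]%g.
Proof. by rewrite /comm_word !word_eval_cat !word_eval_inv commgEl conjgE. Qed.

(** [B] lists the exponents whose conjugates are made to commute with a, and [E] lists words whose
    values will be elements of I. *)
Definition relators : seq (word gens) :=
  [seq comm_word [:: (Some i, false)] [:: (Some j, false)]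
    | i <- enum 'I_k, j <- enum 'I_k]
  ++ [seq comm_word [:: (None, false)] (conj_word [:: (d, false)]) | d <- B]
  ++ [seq conj_word s | s <- E].

Lemma relatorsP (H : groupType) (f : gens -> H) :
  (forall r, r \in relators -> word_eval f r = 1%g) <->
  [/\ forall i j, commute (f (Some i)) (f (Some j)),
      forall d, d \in B -> commute (f None) (aconj f d)
    & forall s, s \in E -> word_eval (aconj f) s = 1%g].
Proof.
have ev (X : Type) (g : X -> H) x : word_eval g [:: (x, false)] = g x.
  by rewrite word_eval_cons word_eval_nil mulg1.
split=> [f1|[fC fB fE] r].
  split=> [i j|d dB|s sE].
  - apply/commgP/eqP.
    have := f1 (comm_word [:: (Some i, false)] [:: (Some j, false)]).
    rewrite word_eval_comm !ev; apply.
    rewrite !mem_cat; apply/or3P/Or31/allpairsP; exists (i, j).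
    by rewrite !mem_enum.
  - apply/commgP/eqP.
    have := f1 (comm_word [:: (None, false)] (conj_word [:: (d, false)])).
    rewrite word_eval_comm word_eval_conj_word !ev; apply.
    by rewrite !mem_cat; apply/or3P/Or32/mapP; exists d.
  - rewrite -word_eval_conj_word; apply: f1.
    by rewrite !mem_cat map_f ?orbT.
rewrite !mem_cat => /or3P[/allpairsP[[i j] [_ _ ->]]|/mapP[d dB ->]|/mapP[s sE ->]].
- by rewrite word_eval_comm !ev; apply/eqP/commgP/fC.
- rewrite word_eval_comm word_eval_conj_word !ev; exact/eqP/commgP/fB.
- by rewrite word_eval_conj_word fE.
Qed.

End Relators.
End ConjugateWords.

(** * Quotient groups, normal closures and universal maps *)

Section Groups.
Local Open Scope group_scope.

Lemma quotient_lift (G H : groupType) (N : normal_subgroup G) (phi : G -> H) :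
  {morph phi : x y / x * y} -> (forall x, nsg_set N x -> phi x = 1) ->
  exists psi : quotient_group N -> H, {morph psi : x y / x * y} /\
    forall x, psi (qg_proj N x) = phi x.
Proof.
move=> phiM phiN.
have E x : phi (qg_repr (qg_proj N x)) = phi x.
  by rewrite -(mulVKg x (qg_repr _)) phiM (phiN (_^-1 * _)) ?mulg1 //; apply: qg_projK.
exists (phi \o @qg_repr _ N); split=> //= x y.
by rewrite -(qg_reprK x) -(qg_reprK y) -qg_projM /= !E phiM.
Qed.

Lemma qg_proj_eq1 (G : groupType) (N : normal_subgroup G) (x : G) :
  qg_proj N x = 1 <-> nsg_set N x.
Proof.
have [[_ _ NV] _] := nsgP N.
rewrite -[1]/(qg_proj N 1) qg_projP mulg1; split=> /NV //.
by rewrite invgK.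
Qed.

Lemma mem_normal_closure (G : groupType) (S : set G) x :
  S x -> nsg_set (normal_closure S) x.
Proof. by move=> Sx N [_]; apply. Qed.

Lemma normal_closure_min (G : groupType) (S N : set G) :
  is_normal N -> S `<=` N -> nsg_set (normal_closure S) `<=` N.
Proof. by move=> nN SN x; apply. Qed.

(** The products of conjugates of relators and their inverses form a normal subgroup. Hence the area
    of a word that is trivial in the quotient is a minimum over a nonempty set. *)
Lemma normal_closure_prod (G : groupType) (S : seq G) x :
  nsg_set (normal_closure [set` S]) x ->
  exists l (u r : 'I_l -> G), (forall i, r i \in S \/ (r i)^-1 \in S) /\
    x = \prod_(i < l) ((u i)^-1 * r i * u i).
Proof.
pose good (p : G * G) := p.2 \in S \/ p.2^-1 \in S.
pose cp (s : seq (G * G)) := \prod_(p <- s) (p.1^-1 * p.2 * p.1).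
pose N := [set x | exists2 s, (forall p, p \in s -> good p) & x = cp s].
suff NP : nsg_set (normal_closure [set` S]) `<=` N.
  case/NP => s gs ->; exists (size s).
  exists (fun i => (tnth (in_tuple s) i).1), (fun i => (tnth (in_tuple s) i).2).
  split=> [i|]; first exact/gs/mem_tnth.
  by rewrite /cp (big_tnth _ _ s).
apply: normal_closure_min => [|r rS]; last first.
  exists [:: (1, r)] => [p|]; first by rewrite inE => /eqP->; left.
  by rewrite /cp big_seq1 /= invg1 mul1g mulg1.
split; first split.
- by exists [::] => //; rewrite /cp big_nil.
- move=> _ _ [s gs ->] [s' gs' ->]; exists (s ++ s'); last by rewrite /cp big_cat.
  by move=> p; rewrite mem_cat => /orP[/gs|/gs'].
- move=> _ [s gs ->]; exists (rev [seq (p.1, p.2^-1) | p <- s]) => [p|].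
    rewrite mem_rev => /mapP[q /gs gq ->]; rewrite /good /= invgK.
    by case: gq; [right|left].
  elim: s {gs} => [|p s IH]; first by rewrite /cp !big_nil invg1.
  rewrite /cp map_cons rev_cons -cats1 big_cat big_seq1 big_cons invgM /=.
  by rewrite -[\prod_(j <- s) _]/(cp s) IH !invgM invgK !mulgA.
move=> _ y [s gs ->]; exists [seq (p.1 * y, p.2) | p <- s].
  by move=> p /mapP[q /gs gq ->].
rewrite /cp big_map conjg_prod; apply: eq_bigr => p _ /=.
by rewrite conjgE invgM !mulgA.
Qed.

End Groups.

(* All that is needed of F(X) and of the free metabelian group on X. *)
Definition sdp_universal (V : ambient) : Prop := forall X : finType,
  (forall h : V X, exists w, h = word_eval (@amb_gen V X) w) /\
  forall (A : zmodType) (M : lmodType {group_ring A}) (f : X -> sdp M),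
    exists phi : V X -> sdp M,
      {morph phi : x y / (x * y)%g} /\ forall x, phi (amb_gen V x) = f x.

Section FreeGroups.
Local Open Scope group_scope.

Lemma fg_word_eval (X : choiceType) (w : word X) :
  fg_word (word_eval (@fg_gen X) w) = foldr (@fg_push X) [::] w.
Proof.
elim: w => [|a w IH]; first by rewrite word_eval_nil.
rewrite word_eval_cons -[LHS]/(foldr _ (fg_word (word_eval _ w)) _) IH.
by case: a => x [].
Qed.

Lemma fg_gen_eval (X : choiceType) (u : free_group X) :
  word_eval (@fg_gen X) (fg_word u) = u.
Proof. by apply: val_inj; rewrite /= fg_word_eval fg_foldr_id //; apply: valP. Qed.

Lemma fg_lift (X : choiceType) (H : groupType) (f : X -> H) :
  exists phi : free_group X -> H, {morph phi : x y / x * y} /\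
    forall x, phi (fg_gen x) = f x.
Proof.
exists (fun u => word_eval f (fg_word u)); split=> [u v|x] /=; last first.
  by rewrite word_eval_cons word_eval_nil mulg1.
rewrite -word_eval_cat.
elim: (fg_word u) => //= a w IH; rewrite word_eval_cons -IH.
set w' := foldr _ _ _; case: w' => [|b w'] /=; first by rewrite word_eval_cons.
case: eqP => [->|_]; last by rewrite word_eval_cons.
rewrite !word_eval_cons mulgA /letter_inv /=.
by case: a.2; rewrite /= ?mulgV ?mulVg mul1g.
Qed.

Lemma absolute_universal : sdp_universal absolute_ambient.
Proof.
move=> X; split=> [h|A M f]; last exact: fg_lift.
by exists (fg_word h); rewrite fg_gen_eval.
Qed.

Lemma metabelian_universal : sdp_universal metabelian_ambient.
Proof.
move=> X; split=> [h|A M f].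
  exists (fg_word (qg_repr h)); rewrite -{1}(qg_reprK h) -{1}(fg_gen_eval (qg_repr h)).
  by apply: morph_word_eval; apply: qg_projM.
have [phi [phiM phif]] := fg_lift f.
have [|psi [psiM psiE]] := quotient_lift (N := second_derived (free_group X)) phiM.
  (* The morphism on the free group kills the second derived subgroup: it sends the derived subgroup
     into M, which is abelian. *)
  apply: (generated_min (is_normal_ker phiM).1) => _ [x [y [x1 y1 ->]]].
  have sub : is_subgroup [set z | (phi z).1 = 0%R].
    split=> /= [|u v|u]; rewrite ?(group_morph1 phiM) ?phiM ?(group_morphV phiM) //.
      by move=> u0 v0; rewrite /= u0 v0 addr0.
    by move=> u0; rewrite /= u0 oppr0.
  have phi' z : derived setT z -> (phi z).1 = 0%R.
    apply: (generated_min sub) => _ [u [v [_ _ ->]]].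
    by rewrite /= (group_morphR phiM) sdp_commg1.
  rewrite /= (group_morphR phiM); apply/eqP/commgP/sdp_commute0; exact: phi'.
by exists psi; split=> // x; rewrite /= /fm_gen psiE phif.
Qed.

End FreeGroups.

Lemma quotient_scale1 (R : comNzRingType) (I : ideal R) (a : R) :
  a *: qm_proj I 1 = qm_proj I a.
Proof. by rewrite -qm_projZ mulr1. Qed.

Lemma quotient_scale1_eq0 (R : comNzRingType) (I : ideal R) (a : R) :
  a *: qm_proj I 1 = 0 <-> ideal_set I a.
Proof.
have <- : qm_proj I 0 = 0 by rewrite -(quotient_scale1 I 0) scale0r.
by rewrite quotient_scale1 qm_projP subr0.
Qed.

(** * Presenting the semidirect product *)

Section NormalForm.
Local Open Scope group_scope.
Variables (k : nat) (H : groupType) (f : option 'I_k -> H).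
Hypothesis tC : forall i j, commute (f (Some i)) (f (Some j)).

(** The letters x_i are collected on the left: since a x^d = x^d a^(x^d), a letter a that passes x^d
    only turns into a conjugate. *)
Lemma word_eval_normal_form w : exists d s,
  word_eval f w = tpow f d * word_eval (aconj f) s.
Proof.
elim: w => [|[[i|] b] w [d [s IH]]].
- by exists 0%R, [::]; rewrite !word_eval_nil tpow0 // mulg1.
- exists ((if b then - expo_unit i else expo_unit i) + d)%R, s.
  rewrite word_eval_cons IH tpowD // mulgA /=; congr (_ * _ * _).
  by case: b; rewrite ?tpowV ?tpow_unit.
exists d, ((d, b) :: s); rewrite !word_eval_cons IH /= !mulgA; congr (_ * _).
by case: b; rewrite -?conjVg /aconj conjgE !mulgA mulgV mul1g.
Qed.

(** As the conjugates of a commute, a product of them depends only on its net exponents. So v has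
    the value of a concatenation of words for the h_j f_j, each made of translates of a trivial
    word. *)
Lemma word_eval_span s (F : 'I_s -> laurent k) (v : word (expo k)) :
  (forall d, commute (f None) (aconj f d)) ->
  (forall j, exists w, lval w = F j /\ word_eval (aconj f) w = 1) ->
  ideal_span F (lval v) -> word_eval (aconj f) v = 1.
Proof.
move=> aC /choice[W WF] [h vE].
have -> : word_eval (aconj f) v = word_eval (aconj f)
    (flatten [seq word_scale (gr_word (h j)) (W j) | j <- enum 'I_s]).
  apply: eq_word_exp_eval => [d e|d]; first exact: commute_aconj.
  rewrite -!gr_coef_lval; congr gr_coef; rewrite vE -big_enum.
  elim: (enum _) => [|j r IH]; first by rewrite big_nil lval_nil.
  by rewrite big_cons IH /= lval_cat lval_scale gr_wordK (WF j).1.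
rewrite word_eval_flatten big1_seq // => j _.
by apply: word_eval_scale => //; case: (WF j).
Qed.

End NormalForm.

(** The one property that the metabelian and the tame case prove differently; with it,
    [word_eval_span] derives all of I from its generators. *)
Definition relators_commute (V : ambient) k (B : seq (expo k))
    (E : seq (word (expo k))) : Prop :=
  forall (H : groupType) (q : V (option 'I_k) -> H),
    {morph q : x y / (x * y)%g} ->
    (forall r, r \in relators B E -> word_eval (q \o @amb_gen V _) r = 1%g) ->
    forall d, commute ((q \o @amb_gen V _) None) (aconj (q \o @amb_gen V _) d).

Lemma area_leN k s (F : 'I_s -> laurent k) g n : area_le F g n -> area_le F (- g) n.
Proof.
have -> : - g = gr_mono (if true then -1 else 1) 0 * g.
  by apply: gr_ext => d; rewrite gr_coefM_mono gr_coefN subr0 mulN1r.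
exact: (area_le_unit 0 true).
Qed.

Section Presentation.
Variables (k s : nat) (F : 'I_s -> laurent k) (I : ideal (laurent k)).
Hypothesis hF : ideal_set I = ideal_span F.
Variables (V : ambient) (B : seq (expo k)) (E : seq (word (expo k))).
Hypothesis univV : sdp_universal V.
Hypothesis EI : forall v, v \in E -> ideal_set I (lval v).
Hypothesis FE : forall j, exists2 v, v \in E & lval v = F j.
Hypothesis relC : relators_commute V B E.

Local Notation gens := (option 'I_k).
Local Notation Q := (quot_module I).

Definition pres_relators : seq (V gens) :=
  [seq word_eval (@amb_gen V gens) r | r <- relators B E].

Local Notation N := (normal_closure [set` pres_relators]).
Local Notation H := (quotient_group N).

(** Stated for any module because it serves twice: over R/I the relators become trivial, while over
    R the element x keeps track of the area. *)
Lemma sdp_relator (M : lmodType (laurent k)) (m : M) r : r \in relators B E ->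
  exists x, word_eval (sdp_gen m) r = sdp_inj (x *: m) /\
    (x = 0 \/ exists2 v, v \in E & x = lval v).
Proof.
rewrite !mem_cat => /or3P[/allpairsP[[i j] [_ _ ->]]|/mapP[d dB ->]|/mapP[v vE ->]].
- exists 0; split; last by left.
  rewrite word_eval_comm scale0r !word_eval_cons !word_eval_nil !mulg1 /=.
  exact/eqP/commgP/sdp_tC.
- exists 0; split; last by left.
  rewrite word_eval_comm scale0r word_eval_conj_word.
  rewrite !word_eval_cons !word_eval_nil !mulg1 sdp_aconj /=.
  by apply/eqP/commgP/sdp_commute0.
- exists (lval v); split; last by right; exists v.
  exact: sdp_conj_word.
Qed.

(** The relators hold in (R/I) x| Q, which gives the map. An element of its kernel has a normal form
    x^d v with d = 0 and [lval v] in I, and is trivial by [word_eval_span]. *)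
Lemma pres_isoP : exists psi : H -> sdp Q, [/\ {morph psi : x y / (x * y)%g},
  forall w, psi (qg_proj N (word_eval (@amb_gen V gens) w)) =
    word_eval (sdp_gen (qm_proj I 1)) w & bijective psi].
Proof.
have [gen lift] := univV gens.
have [phi [phiM phiG]] := lift _ _ (sdp_gen (qm_proj I 1)).
have phiE w : phi (word_eval (@amb_gen V gens) w) =
    word_eval (sdp_gen (qm_proj I 1)) w.
  by rewrite morph_word_eval //; apply: eq_word_eval.
have phiN x : nsg_set N x -> phi x = 1%g.
  apply: (normal_closure_min (is_normal_ker phiM)) => _ /mapP[r rR ->].
  have [y [rE yE]] := sdp_relator (qm_proj I 1) rR.
  rewrite /= phiE rE; case: yE => [->|[v vE ->]]; first by rewrite scale0r.
  by have /quotient_scale1_eq0 -> := EI vE.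
have [psi [psiM psiE]] := quotient_lift phiM phiN.
have psiG w : psi (qg_proj N (word_eval (@amb_gen V gens) w)) =
    word_eval (sdp_gen (qm_proj I 1)) w by rewrite psiE phiE.
exists psi; split=> //.
pose f : gens -> H := qg_proj N \o @amb_gen V gens.
have projE w : qg_proj N (word_eval (@amb_gen V gens) w) = word_eval f w.
  by apply: morph_word_eval; apply: qg_projM.
have fR r : r \in relators B E -> word_eval f r = 1%g.
  move=> rR; rewrite -projE; apply/qg_proj_eq1.
  apply: (@mem_normal_closure _ [set` pres_relators]%classic).
  by apply/mapP; exists r.
have [tC _ fE] := (relatorsP B E f).1 fR.
have aC := relC (@qg_projM _ N) fR.
have inj x : psi x = 1%g -> x = 1%g.
  have [w xw] := gen (qg_repr x).
  rewrite -(qg_reprK x) xw psiG projE.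
  have [d [v wE]] := word_eval_normal_form tC w.
  (* The normal form, which holds in the quotient by the relators, is turned back into the image of
     a word so that [psi] can be computed on it. *)
  have -> : word_eval (sdp_gen (qm_proj I 1)) w = (d, lval v *: qm_proj I 1).
    rewrite -psiG projE wE /tpow -word_eval_conj_word -word_eval_cat -projE psiG.
    rewrite word_eval_cat sdp_conj_word -/(tpow _ d) sdp_tpow sdpM /=.
    by rewrite addr0 scaler0 add0r.
  case=> d0 /quotient_scale1_eq0; rewrite hF => v0.
  rewrite wE d0 tpow0 // mul1g; apply: word_eval_span v0 => // j.
  by have [u uE uF] := FE j; exists u; split => //; apply: fE.
have surj y : exists x, psi x = y.
  exists (qg_proj N (word_eval (@amb_gen V gens)
            (mono_word y.1 ++ conj_word (gr_word (qm_repr y.2))))).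
  rewrite psiG word_eval_cat sdp_conj_word -/(tpow _ _) sdp_tpow gr_wordK sdpM /=.
  by rewrite quotient_scale1 qm_reprK scaler0 addr0 add0r; case: (y).
have [inv invK] := choice surj.
exists inv => // x; apply: divg1_eq; apply: inj.
by rewrite psiM (group_morphV psiM) invK mulgV.
Qed.

(** Under the map to R x| Q, a product of l conjugates of relators becomes a sum of l elements of
    area at most K. For a word that spells g this sum is g itself, whose area is therefore at most K
    l. *)
Lemma sdp_presentation K : (forall v, v \in E -> area_le F (lval v) K) ->
  exists P : presentation V (sdp Q), forall g m n,
    ideal_set I g -> (laurent_norm g <= m)%N -> (laurent_deg g <= n)%N ->
    exists w : word (pres_gens P), [/\ word_group w = 1%g,
      (size w <= m * n.*2.+1)%N & (ideal_area F g <= K * word_area w)%N].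
Proof.
move=> EK; have [psi [psiM psiG psib]] := pres_isoP.
pose psi' : {multiplicative H -> sdp Q} :=
  HB.pack psi (isMultiplicative.Build _ _ psi psiM).
pose P := @Presentation V (sdp Q) gens pres_relators psi' psib.
exists P => g m n Ig gm gn; pose w := conj_word (gr_word g).
have w1 : @word_group _ _ P w = 1%g.
  rewrite /word_group /= psiG sdp_conj_word gr_wordK.
  by have /quotient_scale1_eq0 -> := Ig.
exists w; split=> //.
  apply: (@leq_trans (size (gr_word g) * n.*2.+1)); last first.
    by rewrite leq_mul2r size_gr_word gm orbT.
  apply: size_conj_word => a /gr_supp_gr_word ag; apply: leq_trans gn.
  by rewrite /laurent_deg (big_fsetD1 _ ag) leq_maxl.
pose area l := exists u r : 'I_l -> V gens,
  (forall i, r i \in pres_relators \/ (r i)^-1%g \in pres_relators) /\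
  word_eval (@amb_gen V gens) w = (\prod_(i < l) ((u i)^-1 * r i * u i))%g.
(* Some product of conjugates of relators equals w, so [word_area w] is attained and is not the
   default value of [least]. *)
have [l al] : exists l, area l.
  apply: normal_closure_prod; apply/qg_proj_eq1.
  by apply: (bij_inj psib); rewrite (group_morph1 psiM).
have [[u [r [rS wE]]] _] : area (word_area (P := P) w) /\ _ := leastP al.
have [_ univ] := univV gens.
(* Here a goes to 1 in R and not in R/I, so that w goes to g and not to 0. *)
have [phi [phiM phiG]] := univ _ _ (sdp_gen (1 : (laurent k)^o)).
have phiE v : phi (word_eval (@amb_gen V gens) v) =
    word_eval (sdp_gen (1 : (laurent k)^o)) v.
  by rewrite morph_word_eval //; apply: eq_word_eval.
have area_rel x : x \in pres_relators ->
    exists2 y : (laurent k)^o, phi x = sdp_inj y & area_le F y K.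
  case/mapP=> v vR ->; rewrite phiE.
  have [y [-> yE]] := sdp_relator (1 : (laurent k)^o) vR.
  exists y; first by rewrite [_ *: _]mulr1.
  case: yE => [->|[v' v'E ->]]; last exact: EK.
  exact: area_leW (area_le0 F).
have {}area_rel i : exists2 y : (laurent k)^o,
    phi ((u i)^-1 * r i * u i)%g = sdp_inj y & area_le F y K.
  have [y yE yK] : exists2 y : (laurent k)^o, phi (r i) = sdp_inj y & area_le F y K.
    case: (rS i) => /area_rel // [y yE yK]; exists (- y); last exact: area_leN.
    by rewrite -[r i]invgK (group_morphV phiM) yE sdp_injV.
  exists (gr_mono 1 (phi (u i)).1 * y); last exact: (area_le_unit _ false).
  by rewrite -mulgA -conjgE (group_morphJ phiM) yE sdp_injJ.
have [y yE yK] : exists2 y : (laurent k)^o,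
    phi (word_eval (@amb_gen V gens) w) = sdp_inj y &
    area_le F y (K * word_area (P := P) w).
  rewrite wE; elim: (word_area _) u r area_rel {wE rS} => [|l' IH] u r ur.
    exists 0; first by rewrite big_ord0 (group_morph1 phiM).
    by rewrite muln0; apply: area_le0.
  have [y yE yK] := ur ord0.
  have [z zE zK] := IH (u \o lift ord0) (r \o lift ord0) (fun i => ur (lift ord0 i)).
  exists (y + z); first by rewrite big_ord_recl phiM yE zE sdp_injM.
  by rewrite mulnS; apply: area_leD.
have -> : g = y; last exact: ideal_area_le.
have := yE; rewrite phiE sdp_conj_word gr_wordK => -[<-].
by rewrite [RHS]mulr1.
Qed.

End Presentation.

(** * Commuting conjugates *)

Section CommutingConjugates.
Local Open Scope group_scope.
Variable G : groupType.
Implicit Types x y z : G.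

Lemma commuteJ x y z : commute x y -> commute (x ^ z) (y ^ z).
Proof. by rewrite /commute -!conjMg => ->. Qed.

Lemma conjg_commg x y : x ^ y = x * [~ x, y].
Proof. by rewrite commgEl mulVKg. Qed.

Lemma commute_commg x y : commute x (x ^ y) -> commute x [~ x, y].
Proof. by rewrite commgEl => C; apply: commuteM C; apply: commuteV. Qed.

End CommutingConjugates.

Lemma free_metabelian_commute (X : choiceType) (x y z t : free_metabelian X) :
  commute [~ x, y]%g [~ z, t]%g.
Proof.
rewrite -(qg_reprK x) -(qg_reprK y) -(qg_reprK z) -(qg_reprK t).
rewrite -!(group_morphR (@qg_projM _ _)); apply/commgP/eqP.
rewrite -(group_morphR (@qg_projM _ _)); apply/qg_proj_eq1.
by apply: subset_generated; eexists _, _; split=> //; apply: subset_generated;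
  eexists _, _.
Qed.

(* Since a^y = a [a, y], whatever commutes with a and with all commutators commutes
   with the conjugates of a; for the commutators [a, x_i], this says that all their
   conjugates commute with a. *)
Lemma metabelian_relators_commute k E :
  relators_commute metabelian_ambient [seq expo_unit i | i <- enum 'I_k] E.
Proof.
move=> H q qM fR.
set f := q \o _ in fR *.
have [tC fB _] := (relatorsP _ E f).1 fR.
have ev w : word_eval f w = q (word_eval (@amb_gen metabelian_ambient _) w).
  by rewrite (morph_word_eval _ _ qM).
have CC v w v' w' : commute [~ word_eval f v, word_eval f w]%g
    [~ word_eval f v', word_eval f w']%g.
  rewrite !ev -!(group_morphR qM) /commute -!qM; congr q.
  exact: free_metabelian_commute.
have fa : word_eval f [:: (None, false)] = f None.
  by rewrite word_eval_cons word_eval_nil mulg1.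
(* After conjugation by w^-1 the claim is that [a, v] commutes with a^(w^-1) = a [a, w^-1]: with a
   by hypothesis, with the other factor because commutators commute. *)
have aR v : commute (f None) [~ f None, word_eval f v]%g ->
    forall w, commute (f None) ([~ f None, word_eval f v] ^ word_eval f w)%g.
  move=> aC w; apply/commute_sym; set c := commg _ _ in aC *.
  suff /(@commuteJ _ _ _ (word_eval f w)) : commute c (f None ^ (word_eval f w)^-1)%g.
    by rewrite conjgKV.
  rewrite -word_eval_inv conjg_commg; apply: commuteM; first exact: commute_sym.
  by rewrite /c -fa; apply: CC.
(* For the inverse letter, the relator that makes a and a^(x_i) commute is conjugated by x_i^-1. *)
have aL i b : commute (f None) [~ f None, word_eval f [:: (Some i, b)]]%g.
  apply: commute_commg; rewrite word_eval_cons word_eval_nil mulg1 /=.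
  have aU : commute (f None) (f None ^ f (Some i))%g.
    have := fB (expo_unit i); rewrite /aconj tpow_unit //; apply.
    by rewrite map_f ?mem_enum.
  case: b => //; apply/commute_sym; have := commuteJ (f (Some i))^-1%g aU.
  by rewrite conjgK.
move=> d; rewrite /aconj /tpow.
rewrite /mono_word; elim: (exp_word d _) => [|[i b] w IH].
  by rewrite word_eval_nil conjg1.
(* For a letter t, a^(t w) = a^w [a, t]^w. *)
rewrite map_cons -cat1s word_eval_cat conjgM (conjg_commg (f None)) conjMg.
by apply: commuteM => //; apply: aR.
Qed.

(* If a is a product of conjugates a^u for which every q + u (or every q - u) is
   shorter than q, then a commutes with a^q because it commutes with all the
   a^(q+u) (or because a^q commutes with all the a^u). *)
Lemma bieri_strebel_commute (H : groupType) k (f : option 'I_k -> H)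
    (L : seq (laurent k)) (B : seq (expo k)) (len : expo k -> nat) :
  (forall i j, commute (f (Some i)) (f (Some j))) ->
  (forall d, d \in B -> commute (f None) (aconj f d)) ->
  (forall g, g \in L -> f None = word_eval (aconj f) (gr_word g)) ->
  (forall q : expo k, q \in B \/ exists2 g, g \in L &
    (forall u, u \in gr_supp g -> (len (q + u)%R < len q)%N) \/
    (forall u, u \in gr_supp g -> (len (q - u)%R < len q)%N)) ->
  forall q, commute (f None) (aconj f q).
Proof.
move=> tC fB fL red q; elim: {q}(len q).+1 {-2}q (ltnSn (len q)) => // n IH q qn.
have [/fB //|[g gL]] := red q; have fg := fL g gL.
have mem_word (a : expo k * bool) : List.In a (gr_word g) -> a.1 \in gr_supp g.
  move=> aw; apply: gr_supp_gr_word.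
  elim: (gr_word g) aw => //= b w IHw [->|/IHw aw]; first exact: mem_head.
  by rewrite in_cons aw orbT.
case=> short.
  have -> : aconj f q = word_eval (aconj f) (word_shift q (gr_word g)).
    by rewrite word_eval_shift -?fg.
  rewrite (word_eval_map (fun d => d + q)); apply: commute_word_eval => a /mem_word au /=.
  by apply: IH; rewrite addrC; apply: leq_trans (short _ au) _.
apply/commute_sym; rewrite {1}fg; apply: commute_word_eval => a /mem_word au.
apply/commute_sym/commute_aconj => //.
by apply: IH; apply: leq_trans (short _ au) _.
Qed.

(** * Supports in an open half space *)

Section HalfSpaces.
Variable A : zmodType.
Implicit Types (g h : {group_ring A}) (u : A).

Lemma mem_gr_supp g u : (u \in gr_supp g) = (gr_coef g u != 0).
Proof. by rewrite mem_finsupp. Qed.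

Lemma gr_supp_sumP (J : Type) (r : seq J) (P : J -> {group_ring A}) u :
  u \in gr_supp (\sum_(j <- r) P j) -> exists j, u \in gr_supp (P j).
Proof.
elim: r => [|j r IH]; first by rewrite big_nil mem_gr_supp gr_coef0 eqxx.
rewrite big_cons => /(fsubsetP (gr_suppD _ _)); rewrite in_fsetU => /orP[uj|/IH //].
by exists j.
Qed.

Lemma gr_supp_mulP g h u : u \in gr_supp (g * h) ->
  exists a b, [/\ a \in gr_supp g, b \in gr_supp h & u = a + b].
Proof.
rewrite -[g * h]/(gr_mul g h) => /gr_supp_sumP[a /gr_supp_sumP[b]].
rewrite mem_gr_supp gr_coef_mono; case: (a + b =P u) => [<- c|_].
  exists a, b; split=> //; apply: contraNT c => /gr_out ->.
    by rewrite mul0r.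
  by rewrite mulr0.
by rewrite mulr0n eqxx.
Qed.

Variable RR : realType.

(* Multiplying the generators of R/I into the positive half space by one large
   monomial x^q expresses x^(-q) through them. *)
Lemma fg_over_unit (chi : A -> RR) (I : ideal {group_ring A}) (q : A) :
  {morph chi : x y / x + y} -> 0 < chi q -> fg_over chi (quot_module I) ->
  exists2 g, ideal_set I (g - 1) & forall u, u \in gr_supp g -> 0 < chi u.
Proof.
move=> chiD q0 [r [e eP]].
pose p i := qm_repr (e i).
have [n nP] : exists n : nat, forall i b, b \in gr_supp (p i) -> 0 < chi (q *+ n) + chi b.
  (* [W] bounds |chi| on the supports of all the p_i, so any n > W / chi(q) makes chi positive on
     the support of each x^(nq) p_i. *)
  pose W := \sum_i \sum_(b <- gr_supp (p i)) `|chi b|.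
  have W0 : 0 <= W by apply: sumr_ge0 => i _; apply: sumr_ge0.
  exists (Num.truncn (W / chi q)).+1 => i b bp.
  have chiX m : chi (q *+ m.+1) = chi q *+ m.+1.
    by elim: m => // m IH; rewrite !(mulrS _ m.+1) chiD IH.
  have bW : `|chi b| <= W.
    rewrite /W (bigD1 i) //= (big_fsetD1 b) //= -addrA lerDl addr_ge0 //.
      exact: sumr_ge0.
    by apply: sumr_ge0 => j _; apply: sumr_ge0.
  have : W < chi (q *+ (Num.truncn (W / chi q)).+1).
    rewrite chiX -mulr_natl -ltr_pdivrMr //.
    by apply: truncnS_gt.
  by move=> Wn; move: bW; rewrite ler_norml => /andP[bW _]; lra.
have [c [cP cE]] := eP (qm_proj I (gr_mono 1 (- (q *+ n)))).
(* In R/I the sum of the c_i p_i is x^(-nq), so this element is 1 modulo I. The c_i are supported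
   where chi >= 0 and keep the x^(nq) p_i in the positive half space. *)
exists (gr_mono 1 (q *+ n) * \sum_i c i * p i).
  apply/qm_projP; rewrite qm_projZ.
  have -> : qm_proj I (\sum_i c i * p i) = qm_proj I (gr_mono 1 (- (q *+ n))).
    rewrite cE -[LHS]quotient_scale1 scaler_suml; apply: eq_bigr => i _.
    by rewrite quotient_scale1 qm_projZ qm_reprK.
  by rewrite -qm_projZ gr_monoM mulr1 subrr.
move=> u /gr_supp_mulP[a [b [/(fsubsetP (gr_supp_mono _ _))]]].
rewrite in_fset1 => /eqP-> /gr_supp_sumP[i /gr_supp_mulP[d [v [dc vp ->]]]] ->.
have := cP i d dc; have := nP i v vp; rewrite !chiD; lra.
Qed.

End HalfSpaces.

(** * Finitely many half spaces *)

(** The square of the Euclidean length is a natural number, which permits induction, and it changes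
    under translation by an inner product. *)
Definition sqnorm k (d : expo k) : nat := (\sum_i `|d i| ^ 2)%N.

Section Weights.
Variables (RR : realType) (k : nat).
Implicit Types (chi : 'rV[RR]_k) (q u d : expo k).

(** A row encodes the character with these values on the x_i, so that characters inherit the
    topology of a normed space. *)
Definition weight chi d : RR := \sum_i chi 0 i * (d i)%:~R.

Fact weight_zmod_morphism chi : zmod_morphism (weight chi).
Proof.
move=> d e; rewrite /weight -sumrB; apply: eq_bigr => i _.
by rewrite !ffunE rmorphB mulrBr.
Qed.

HB.instance Definition _ chi :=
  GRing.isZmodMorphism.Build (expo k) RR (weight chi) (weight_zmod_morphism chi).

Definition expo_row q : 'rV[RR]_k := \row_i (q i)%:~R.

Lemma natr_sqnorm q : (sqnorm q)%:R = \sum_i (q i)%:~R ^+ 2 :> RR.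
Proof.
rewrite natr_sum; apply: eq_bigr => i _.
by rewrite natrX -[in RHS]real_normK ?num_real // -intr_norm -abszE.
Qed.

(** The linear term is twice the value at u of the character with row q; this is the link between
    lengths and characters. *)
Lemma natr_sqnormD q u :
  (sqnorm (q + u))%:R = (sqnorm q)%:R + 2 * weight (expo_row q) u + (sqnorm u)%:R :> RR.
Proof.
rewrite !natr_sqnorm mulr_sumr -!big_split; apply: eq_bigr => i _ /=.
by rewrite !mxE ffunE rmorphD /=; ring.
Qed.

Lemma weightZ c chi d : weight (c *: chi) d = c * weight chi d.
Proof. by rewrite mulr_sumr; apply: eq_bigr => i _; rewrite mxE mulrA. Qed.

Lemma ler_coord_norm chi i : `|chi 0 i| <= `|chi|.
Proof.
rewrite [X in _ <= X]mx_normrE.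
by rewrite (bigmaxD1 (0, i)) //= le_max lexx.
Qed.

Lemma continuous_weight d : continuous (weight^~ d : 'rV[RR]_k -> RR).
Proof.
apply: continuous_big => [|i _ chi]; first exact: add_continuous.
by apply: (@cvgMr_tmp _ _ (nbhs chi)); exact: coord_continuous.
Qed.

(** The norm of rows is the maximum norm, so this is the surface of a cube; it still meets the ray
    of every nonzero character. *)
Lemma compact_unit_sphere : compact [set chi : 'rV[RR]_k | `|chi| = 1].
Proof.
apply: bounded_closed_compact.
  by exists 1; split; rewrite ?num_real // => M M1 chi /= ->; apply: ltW.
have cl := (continuous_closedP (Num.norm : 'rV[RR]_k -> RR)).1 (@norm_continuous RR _).
by apply: (cl [set x | x = 1]); apply: closed_eq.
Qed.

End Weights.

Section TameIdeals.
Variables (RR : realType) (k : nat) (I : ideal (laurent k)).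
Implicit Types (chi : 'rV[RR]_k) (g : laurent k) (q u : expo k).

Lemma seq_lower_bound (T : eqType) (r : seq T) (f : T -> RR) :
  (forall x, x \in r -> 0 < f x) ->
  exists n : nat, forall x, x \in r -> n.+1%:R^-1 < f x.
Proof.
elim: r => [|v r IH] f0; first by exists 0%N.
have [|n nP] := IH; first by move=> x xr; rewrite f0 // in_cons xr orbT.
have fv : 0 < f v by rewrite f0 ?mem_head.
exists (maxn n (Num.truncn (f v)^-1)) => x; rewrite in_cons => /orP[/eqP->|/nP].
  rewrite invf_plt ?posrE ?ltr0n //; apply: lt_le_trans (truncnS_gt _) _.
  by rewrite ler_nat ltnS leq_maxr.
apply: le_lt_trans; rewrite lef_pV2 ?posrE ?ltr0n //.
by rewrite ler_nat ltnS leq_maxl.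
Qed.

Lemma weight_pos chi : chi != 0 -> exists q, 0 < weight chi q.
Proof.
move=> chi0; have [i ci] : exists i, chi 0 i != 0.
  apply: contrapT => n0; move/eqP: chi0; apply; apply/rowP => i; rewrite mxE.
  by apply: contrapT => /eqP ci; apply: n0; exists i.
have wi : weight chi (expo_unit i) = chi 0 i.
  rewrite /weight (bigD1 i) //= ffunE eqxx mulr1 big1 ?addr0 // => j /negbTE.
  by rewrite ffunE eq_sym => ->; rewrite mulr0.
have [c0|c0|c0] := ltrgtP (chi 0 i) 0; last by rewrite c0 eqxx in ci.
  by exists (- expo_unit i); rewrite raddfN /= wi oppr_gt0.
by exists (expo_unit i); rewrite wi.
Qed.

(** Each alternative of tameness goes through [fg_over_unit], with a monomial q of positive weight
    or with -q. *)
Lemma tame_half_space chi : tame_ideal RR I -> chi != 0 ->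
  exists2 g, ideal_set I (g - 1) &
    (forall u, u \in gr_supp g -> 0 < weight chi u) \/
    (forall u, u \in gr_supp g -> 0 < - weight chi u).
Proof.
move=> tI chi0; have [q q0] := weight_pos chi0.
have [fg|fg] := tI (weight chi).
  have [|g gI gP] := fg_over_unit _ q0 fg; first exact: raddfD.
  by exists g => //; left.
have [||g gI gP] := fg_over_unit (q := - q) _ _ fg.
- by move=> x y; rewrite raddfD opprD.
- by rewrite raddfN opprK.
by exists g => //; right.
Qed.

(** The number [gn.2] records a margin 1/(n + 1) by which the support stays off the boundary of the
    half space, and c = 1 or -1 chooses the side. Finitely many such margins give a uniform radius
    for the shortening. *)
Definition half_sphere (c : RR) (gn : laurent k * nat) : set 'rV[RR]_k :=
  \bigcap_(u in [set` gr_supp gn.1]) [set chi | gn.2.+1%:R^-1 < c * weight chi u].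

Lemma open_half_sphere c gn : open (half_sphere c gn).
Proof.
rewrite openE => chi hchi; apply: filter_bigI => u ug.
apply: (@open_nbhs_nbhs _ chi); split; last exact: hchi.
apply: (@open_comp _ _ (fun chi => c * weight chi u) [set x | gn.2.+1%:R^-1 < x]).
  by move=> x _; apply: (@cvgMl_tmp _ _ (nbhs x)); apply: continuous_weight.
exact: open_gt.
Qed.

Lemma tame_finite_cover : tame_ideal RR I ->
  exists (L : {fset laurent k * nat}),
    (forall gn, gn \in L -> ideal_set I (gn.1 - 1)) /\
    forall chi, `|chi| = 1 -> exists2 gn, gn \in L &
      half_sphere 1 gn chi \/ half_sphere (- 1) gn chi.
Proof.
move=> tI; have := @compact_unit_sphere RR k.
rewrite compact_cover => /(_ _ [set gn | ideal_set I (gn.1 - 1)]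
  (fun gn => half_sphere 1 gn `|` half_sphere (- 1) gn)).
case=> [gn _|chi /= chi1|L LI Lcov].
- by apply: openU; apply: open_half_sphere.
- have [|g gI gP] := tame_half_space tI (chi := chi).
    by rewrite -normr_eq0 chi1 oner_eq0.
  case: gP => /seq_lower_bound[n nP]; exists (g, n) => //.
    by left=> u ug; rewrite /= mul1r; apply: nP.
  by right=> u ug; rewrite /= mulN1r; apply: nP.
exists L; split=> [gn gL|chi chi1]; first by have := LI _ gL; rewrite inE.
by have [gn gL gP] := Lcov _ chi1; exists gn.
Qed.

(** Up to sign, q/|q| has values above some margin 1/(n + 1) on the support of one of finitely many
    g, so the inner product q.u exceeds |q|/(n + 1). For large q this beats the square of the length
    of u, and subtracting u (adding it, for the other sign) shortens q. *)
Lemma tame_shortening : tame_ideal RR I ->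
  exists (L : seq (laurent k)) (n : nat),
    (forall g, g \in L -> ideal_set I (g - 1)) /\
    forall q, (exists i, n < `|q i|)%N -> exists2 g, g \in L &
      (forall u, u \in gr_supp g -> (sqnorm (q + u)%R < sqnorm q)%N) \/
      (forall u, u \in gr_supp g -> (sqnorm (q - u)%R < sqnorm q)%N).
Proof.
move=> /tame_finite_cover[L [LI Lcov]].
(* [U] bounds the squared lengths in the supports and [M] the inverse margins, so a coordinate above
   U M makes |q| times any margin exceed U. *)
pose U := (\max_(gn <- L) (\max_(u <- gr_supp gn.1) sqnorm u))%N.
pose M := (\max_(gn <- L) gn.2.+1)%N.
exists [seq gn.1 | gn <- L], (U * M)%N; split=> [g /mapP[gn gL ->]|q [i qi]].
  exact: LI.
pose rho := `|expo_row RR q|.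
have rhoUM : U%:R * M%:R < rho.
  apply: lt_le_trans (ler_coord_norm _ i); rewrite mxE -natrM.
  by rewrite -intr_norm -abszE ltr_nat.
have rho0 : 0 < rho by apply: le_lt_trans rhoUM; rewrite mulr_ge0.
have [|gn gL gP] := Lcov (rho^-1 *: expo_row RR q).
  by rewrite normrZ gtr0_norm ?invr_gt0 // mulVf ?gt_eqF.
exists gn.1; first exact: map_f.
have bound c u : u \in gr_supp gn.1 ->
    gn.2.+1%:R^-1 < c * weight (rho^-1 *: expo_row RR q) u ->
    (sqnorm u)%:R < c * weight (expo_row RR q) u.
  move=> ug; rewrite weightZ => lt_c.
  have uU : (sqnorm u <= U)%N.
    apply: (@leq_trans (\max_(v <- gr_supp gn.1) sqnorm v)).
      exact: (leq_bigmax_seq u ug isT).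
    exact: (leq_bigmax_seq gn gL isT).
  have nM : (gn.2.+1 <= M)%N by apply: (leq_bigmax_seq gn gL isT).
  have Un : U%:R * gn.2.+1%:R <= U%:R * M%:R :> RR by rewrite ler_wpM2l ?ler_nat.
  have n0 : 0 < gn.2.+1%:R :> RR by rewrite ltr0n.
  have Urho : U%:R < rho / gn.2.+1%:R.
    by rewrite ltr_pdivlMr //; apply: le_lt_trans rhoUM.
  apply: (@le_lt_trans _ _ U%:R); first by rewrite ler_nat.
  apply: lt_trans Urho _; rewrite -(ltr_pM2l (_ : 0 < rho^-1)) ?invr_gt0 //.
  by rewrite mulrA mulVf ?gt_eqF // mul1r mulrCA.
have sq0 u : 0 <= (sqnorm u)%:R :> RR by [].
(* If q.u > u.u, the square of the length of q - u is q.q - 2 q.u + u.u < q.q - u.u; if -q.u > u.u,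
   the same holds for q + u. *)
case: gP => gP; [right|left] => u ug.
  have := bound _ _ ug (gP u ug); rewrite mul1r -(ltr_nat RR) natr_sqnormD => Lu.
  have -> : sqnorm (- u) = sqnorm u.
    by apply: eq_bigr => j _; rewrite ffunE abszN.
  by rewrite raddfN /=; have := sq0 u; lra.
have := bound _ _ ug (gP u ug); rewrite mulN1r -(ltr_nat RR) natr_sqnormD => Lu.
by have := sq0 u; lra.
Qed.

End TameIdeals.

(** * The Dehn functions *)

Definition expo_box k (n : nat) : seq (expo k) :=
  [seq [ffun i => (f i)%:Z - n%:Z] | f : {ffun 'I_k -> 'I_n.*2.+1}].

Lemma mem_expo_box k n (q : expo k) : (forall i, `|q i| <= n)%N -> q \in expo_box k n.
Proof.
move=> qn; apply/mapP; exists [ffun i => inord `|q i + n%:Z|].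
  by rewrite mem_enum.
apply/ffunP => i; rewrite !ffunE inordK; move: (q i) (qn i) => x; lia.
Qed.

(** The larger list [E'] leaves room for the words of the generators of I. *)
Lemma tame_relators_commute (RR : realType) k (I : ideal (laurent k)) :
  tame_ideal RR I ->
  exists (B : seq (expo k)) (E : seq (word (expo k))),
    (forall v, v \in E -> ideal_set I (lval v)) /\
    forall E', {subset E <= E'} -> relators_commute absolute_ambient B E'.
Proof.
case/tame_shortening=> L [n [LI Lq]].
(* The box holds the exponents with all coordinates at most n in absolute value, which
   [tame_shortening] does not shorten. The words spell a^-1 a^g and have value g - 1. *)
exists (expo_box k n), [seq (0, true) :: gr_word g | g <- L]; split.
  move=> _ /mapP[g gL ->]; rewrite lval_cons gr_wordK.
  have -> : gr_mono (-1) 0 = -1 :> laurent k.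
    by apply: gr_ext => d; rewrite gr_coefN !gr_coef_mono mulNrn.
  by rewrite addrC; apply: LI.
move=> E' EE' H q qM fR.
have [tC fB fE] := (relatorsP _ _ _).1 fR.
apply: (bieri_strebel_commute (L := L) (len := @sqnorm k) tC fB) => [g gL|d].
  have : word_eval (aconj (q \o @amb_gen absolute_ambient _))
      ((0, true) :: gr_word g) = 1%g.
    by apply/fE/EE'/mapP; exists g.
  by rewrite word_eval_cons /= aconj0 // => /mulg1_eq; rewrite invgK.
have [dn|/existsNP[i /negP]] := pselect (forall i, `|d i| <= n)%N.
  by left; apply: mem_expo_box.
by rewrite -ltnNge => di; right; apply: Lq; exists i.
Qed.

Lemma sdp_finitely_generated k (I : ideal (laurent k)) :
  finitely_generated (sdp (quot_module I)).
Proof.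
exists [seq sdp_gen (qm_proj I 1) x | x <- enum {: option 'I_k}].
apply/seteqP; split=> // y _.
have -> : y = word_eval (sdp_gen (qm_proj I 1))
    (mono_word y.1 ++ conj_word (gr_word (qm_repr y.2))).
  rewrite word_eval_cat sdp_conj_word -/(tpow _ _) sdp_tpow gr_wordK sdpM /=.
  by rewrite quotient_scale1 qm_reprK scaler0 addr0 add0r; case: (y).
set A := [set` _]%classic; have [A1 AM AV] := generated_subgroup A.
elim: (_ ++ _) => [|a w IH]; first by rewrite word_eval_nil.
have Aa : generated A (sdp_gen (qm_proj I 1) a.1).
  by apply: subset_generated; apply/mapP; exists a.1; rewrite ?mem_enum.
by rewrite word_eval_cons; apply: AM => //; case: a.2 Aa => // /AV.
Qed.

Section Complexity.
Variables (RR : realType) (k s : nat) (F : 'I_s -> laurent k) (I : ideal (laurent k)).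
Hypothesis hF : ideal_set I = ideal_span F.

Lemma area_le_bound (E : seq (word (expo k))) :
  (forall v, v \in E -> ideal_set I (lval v)) ->
  exists K, forall v, v \in E -> area_le F (lval v) K.
Proof.
elim: E => [|v E IH] EI; first by exists 0%N.
have [|K KE] := IH; first by move=> w wE; apply: EI; rewrite in_cons wE orbT.
have [n vn] : exists n, area_le F (lval v) n.
  by apply: area_le_span; rewrite -hF; apply: EI; apply: mem_head.
exists (maxn n K) => w; rewrite in_cons => /orP[/eqP->|/KE].
  by apply: area_leW vn; apply: leq_maxl.
by apply: area_leW; apply: leq_maxr.
Qed.

Lemma complexity_le_dehn (V : ambient) (G : groupType) (P : presentation V G) K :
  (forall g m n, ideal_set I g -> (laurent_norm g <= m)%N -> (laurent_deg g <= n)%N ->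
    exists w : word (pres_gens P), [/\ word_group w = 1%g,
      (size w <= m * n.*2.+1)%N & (ideal_area F g <= K * word_area w)%N]) ->
  forall (m n : nat) (c : RR), (1 <= n)%N -> 3 <= c ->
    (complexity F RR I m n <= K%:R%:E * dehn P (c * (m%:R * n%:R))%R)%E.
Proof.
move=> PK m n c n1 c3; apply: ge_ereal_sup => _ [g [Ig [gm gn]] <-].
have [w [w1 wsize warea]] := PK g m n Ig gm gn.
apply: (@le_trans _ _ ((K * word_area w)%N%:R%:E)%E); first by rewrite lee_fin ler_nat.
rewrite natrM EFinM lee_wpmul2l ?lee_fin //.
apply: ereal_sup_ubound; exists w => //; split=> //.
apply: (@le_trans _ _ (3 * (m%:R * n%:R))); last by rewrite ler_wpM2r ?mulr_ge0.
(* Since n >= 1, m (2n + 1) <= 3 m n. *)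
rewrite -!natrM ler_nat; apply: leq_trans wsize _; nia.
Qed.

End Complexity.

Theorem theoremB (RR : realType) (k : nat) (hk : (1 <= k)%N)
    (I : ideal (laurent k)) (s : nat) (F : 'I_s -> laurent k)
    (hF : ideal_set I = ideal_span F) :
  exists G : groupType,
    [/\ finitely_generated G, metabelian G,
        exists (P : presentation metabelian_ambient G) (C : RR),
          (0 < C)%R /\
          forall m n : nat, (1 <= m)%N -> (1 <= n)%N ->
            (complexity F RR I m n <= dehn P (C * (m%:R * n%:R))%R)%E
      & tame_ideal RR I ->
        exists (P' : presentation absolute_ambient G) (C' : RR),
          (0 < C')%R /\
          forall m n : nat, (1 <= m)%N -> (1 <= n)%N ->
            (complexity F RR I m n <=
               C'%:E * dehn P' (C' * (m%:R * n%:R))%R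
               + (C' * (m%:R * n%:R) + C')%R%:E)%E ].
Proof.
pose EF := [seq gr_word (F j) | j <- enum 'I_s].
have EFarea v : v \in EF -> area_le F (lval v) 1.
  by case/mapP=> j _ ->; rewrite gr_wordK; apply: area_le_gen.
have EFI v : v \in EF -> ideal_set I (lval v).
  by move=> /EFarea[h [vh _]]; rewrite hF; exists h.
have FE j : exists2 v, v \in EF & lval v = F j.
  exists (gr_word (F j)); last exact: gr_wordK.
  by apply/mapP; exists j; rewrite ?mem_enum.
exists (sdp (quot_module I)); split.
- exact: sdp_finitely_generated.
- exact: sdp_metabelian.
- have [P PK] := sdp_presentation hF metabelian_universal EFI FE
    (@metabelian_relators_commute k EF) EFarea.
  (* The words in [EF] have area at most 1, so K = 1 and no factor appears before the Dehn
     function. *)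
  exists P, 3; split=> // m n _ n1; rewrite -[leRHS]mul1e.
  exact: complexity_le_dehn PK _ _ _ n1 _.
move=> /tame_relators_commute[B [E [EI BE]]].
have E'I v : v \in E ++ EF -> ideal_set I (lval v).
  by rewrite mem_cat => /orP[/EI|/EFI].
have FE' j : exists2 v, v \in E ++ EF & lval v = F j.
  by have [v vE vF] := FE j; exists v; rewrite // mem_cat vE orbT.
have [K KE] := area_le_bound hF E'I.
have EE' : {subset E <= E ++ EF} by move=> v vE; rewrite mem_cat vE.
have [P PK] := sdp_presentation hF absolute_universal E'I FE' (BE _ EE') KE.
(* This is at least 3, for the length of the words, and at least K, for the area of the relators. *)
exists P, (K.+3)%:R; split=> [|m n _ n1]; first by rewrite ltr0n.
have c3 : 3 <= K.+3%:R :> RR by rewrite ler_nat.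
apply: le_trans (complexity_le_dehn PK m n1 c3) _; rewrite -[leLHS]adde0.
apply: leeD; last by rewrite lee_fin addr_ge0 ?mulr_ge0.
apply: lee_wpmul2r; last by rewrite lee_fin ler_nat -addn3 leq_addr.
(* The empty word shows that the Dehn function is nonnegative, so that the factor K may be raised to
   K + 3. *)
apply: (@le_trans _ _ (word_area (P := P) [::])%:R%:E); first by rewrite lee_fin.
apply: ereal_sup_ubound; exists [::] => //; split; last by rewrite mulr_ge0.
rewrite /word_group /word_amb word_eval_nil (group_morph1 (@qg_projM _ _)).
exact: group_morph1 (@gmulfM _ _ _).
Qed.
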